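(* Let $\mathcal T$ be a theory (set of formulas) and $\Phi$ a formula of $\mathsf{LAEPC}$. Then $\mathcal T\vdash_{\mathsf{LAEPC}}\Phi$ if and only if $\mathcal T\models_{\mathsf{LAEPC}}\Phi$.
   Context: Fix a finite set $V\subseteq[0,1]$ with $0,1\in V$ and an associative, commutative binary operation $\odot$ on $V$ with neutral element $1$, monotone in both arguments. Fix $M\geq1$ and, for each $i=1,\dots,M$, finitely many sorted variables $\phi_{i1},\dots,\phi_{iN_i}$ (of sort $i$), plus finitely many unsorted variables $\psi_1,\dots,\psi_N$; $\bot,\top$ belong to every sort. Basic expressions (set $\mathcal B$) are built from all variables and $\bot,\top$ by $\land,\lor,\neg,\Diamond^{\leq},\Diamond^{\geq}$. A basic expression is of sort $i$ (one-sorted) if all its variables are of sort $i$. A diamond expression is one of the form $\Diamond^{\leq}\phi$ or $\Diamond^{\geq}\phi$. Graded implications $\phi\Rightarrow_c\psi$ ($\phi,\psi\in\mathcal B$, $c\in V$) and formulas (classical Boolean combinations of graded implications, with $\to,\leftrightarrow$ defined classically) are as usual. A m.e.c. is a conjunction of literals (variables or negated variables) in which every sorted variable occurs exactly once; a one-sorted m.e.c. is a conjunction of literals in which all variables of one sort $i$ occur exactly once. Two basic expressions are disjoint-sorted if all their variables are sorted and no variable of one has the same sort as a variable of the other. Semantics: a similarity space is $(W,S)$, $W\neq\emptyset$, $S\colon W^2\to V$, $S(u,v)=1$ iff $u=v$, $S$ symmetric, $S(u,w)\geq S(u,v)\odot S(v,w)$. A totally ordered similarity space $(W_i,S_i,\sqsubseteq_i)$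 is a finite similarity space with a total order such that $u\sqsubseteq_i v\sqsubseteq_i w$ implies $\min(S_i(u,v),S_i(v,w))\geq S_i(u,w)$. A component-wise ordered similarity space is $(W,S,(\leqslant_i)_i)$ with $W=\prod_{i=1}^MW_i$ for totally ordered similarity spaces $(W_i,S_i,\sqsubseteq_i)$, $S(v,w)=\min_iS_i(v_i,w_i)$, and $v\leqslant_i w$ iff $v_i\sqsubseteq_i w_i$. For $A\subseteq W$: $\Diamond^{\leq}A=\{w:\forall i\,\exists v\in A,\ w\leqslant_i v\}$, $\Diamond^{\geq}A=\{w:\forall i\,\exists v\in A,\ v\leqslant_i w\}$, $U_c(A)=\{w:\exists a\in A,\ S(w,a)\geq c\}$; for $C\subseteq W_i$, $\pi C=\{w\in W:w_i\in C\}$. An evaluation is $e\colon\mathcal B\to\mathcal P(W)$ preserving $\land,\lor,\neg$ as intersection, union, complement, with $e(\bot)=\emptyset$, $e(\top)=W$, such that distinct $v,w\in W$ are separated by some variable $\phi$ ($e(\phi)$ contains exactly one of them), and moreover: (i) for a variable $\phi$ of sort $i$, $e(\phi)=\pi A$ for some $A\subseteq W_i$; (ii) for an unsorted variable $\alpha$, $e(\alpha)$ is a union of intersections of sets $e(\phi)$ or $W\setminus e(\phi)$ with $\phi$ sorted variables; (iii) $e(\Diamond^{\leq}\phi)=\Diamond^{\leq}e(\phi)$ and $e(\Diamond^{\geq}\phi)=\Diamond^{\geq}e(\phi)$. $e$ satisfies $\phi\Rightarrow_c\psi$ iff $e(\phi)\subseteq U_c(e(\psi))$, compound formulas classically. $\mathcal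 T\models_{\mathsf{LAEPC}}\Phi$ means every evaluation in every component-wise ordered similarity space satisfying all of $\mathcal T$ satisfies $\Phi$. Proof system: $\mathcal T\vdash_{\mathsf{LAEPC}}\Phi$ means derivability from $\mathcal T$ and the following axioms (all $\phi,\psi,\chi\in\mathcal B$, $c,d\in V$) by modus ponens: (A1') $\phi\Rightarrow_1\psi$ whenever $\phi,\psi$ arise from classical formulas $\phi',\psi'$ with $\phi'\to\psi'$ a classical tautology by uniform replacement of variables by basic expressions; (A2) $(\phi\Rightarrow_1\psi)\to(\phi\land\neg\psi\Rightarrow_1\bot)$; (A3) $(\phi\Rightarrow_c\psi)\to(\phi\Rightarrow_d\psi)$, $d\leq c$; (A4) $\neg(\psi\Rightarrow_1\bot)\to(\phi\Rightarrow_0\psi)$; (A5) $(\phi\Rightarrow_c\bot)\to(\phi\Rightarrow_1\bot)$; (A6) $\neg(\delta\Rightarrow_1\bot)\land(\delta\Rightarrow_c\epsilon)\to(\epsilon\Rightarrow_c\delta)$, $\delta,\epsilon$ m.e.c.'s; (A7) $(\phi\Rightarrow_c\chi)\land(\psi\Rightarrow_c\chi)\to(\phi\lor\psi\Rightarrow_c\chi)$; (A8) $(\epsilon\Rightarrow_c\phi\lor\psi)\to(\epsilon\Rightarrow_c\phi)\lor(\epsilon\Rightarrow_c\psi)$, $\epsilon$ a m.e.c.; (A9) $(\phi\Rightarrow_c\psi)\land(\psi\Rightarrow_d\chi)\to(\phi\Rightarrow_{c\odot d}\chi)$; (A10) $\neg(\top\Rightarrow_1\bot)$; (A11) all formulas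 obtained from classical tautologies by uniformly replacing variables by graded implications; (A12) $\phi\Rightarrow_1\Diamond^{\leq}\phi$, $\phi\Rightarrow_1\Diamond^{\geq}\phi$; (A13) $\Diamond^{\leq}\Diamond^{\leq}\phi\Rightarrow_1\Diamond^{\leq}\phi$, $\Diamond^{\geq}\Diamond^{\geq}\phi\Rightarrow_1\Diamond^{\geq}\phi$; (A14) $\Diamond^{\leq}\bot\Rightarrow_1\bot$, $\Diamond^{\geq}\bot\Rightarrow_1\bot$; (A15) for $\phi,\psi$ of one common sort: $(\Diamond^{\leq}\phi\Rightarrow_1\Diamond^{\leq}\psi)\lor(\Diamond^{\leq}\psi\Rightarrow_1\Diamond^{\leq}\phi)$ and likewise for $\Diamond^{\geq}$; (A16) $\Diamond^{\leq}\epsilon\land\Diamond^{\geq}\epsilon\Rightarrow_1\epsilon$ for a one-sorted m.e.c. $\epsilon$; (A17) $(\phi\Rightarrow_c\psi)\to(\Diamond^{\leq}\phi\Rightarrow_c\Diamond^{\leq}\psi)$ and likewise for $\Diamond^{\geq}$; (A18) for one-sorted $\phi$: $(\phi\land\Diamond^{\leq}\psi\Rightarrow_1\bot)\to(\Diamond^{\geq}\phi\land\Diamond^{\leq}\psi\Rightarrow_1\bot)$ and $(\phi\land\Diamond^{\geq}\psi\Rightarrow_1\bot)\to(\Diamond^{\leq}\phi\land\Diamond^{\geq}\psi\Rightarrow_1\bot)$; (A19) $\neg(\rho\land\sigma\Rightarrow_1\bot)\land(\phi\Rightarrow_c\rho)\land(\phi\Rightarrow_c\sigma)\to(\phi\Rightarrow_c\rho\land\sigma)$,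 $\rho,\sigma$ conjunctions of diamond expressions; (A20) $\neg(\phi\land\phi'\Rightarrow_1\bot)\to\big((\phi\Rightarrow_c\psi)\land(\phi'\Rightarrow_c\psi')\leftrightarrow(\phi\land\phi'\Rightarrow_c\psi\land\psi')\big)$, where $\phi\land\psi$ and $\phi'\land\psi'$ are disjoint-sorted; (A21) $(\Diamond^{\geq}\phi\land\chi\land\psi\Rightarrow_1\bot)\to(\Diamond^{\geq}\phi\land\chi\Rightarrow_1\bot)\lor(\Diamond^{\geq}\phi\land\psi\Rightarrow_1\bot)$ and the same with $\Diamond^{\leq}$, where $\chi,\psi$ are disjoint-sorted; (A22) $(\epsilon\Rightarrow_1\alpha)\lor(\epsilon\Rightarrow_1\neg\alpha)$, where $\epsilon$ is a m.e.c. and $\alpha$ an unsorted variable. *)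

(* Defs.v *)
From HB Require Import structures.
From mathcomp Require Import all_boot all_order all_algebra.
From mathcomp Require Import finmap reals.

Set Implicit Arguments.
Unset Strict Implicit.
Unset Printing Implicit Defensive.

Import Order.TTheory GRing.Theory Num.Theory.
Local Open Scope ring_scope.

Record grades (R : realType) := Grades {
  gset :> {fset R};
  gset_itv : forall c : R, c \in gset -> 0 <= c <= 1;
  gset0 : 0 \in gset;
  gset1 : 1 \in gset;
  odot : gset -> gset -> gset;
  odotA : associative odot;
  odotC : commutative odot;
  odot1 : left_id [` gset1]%fset odot;
  odot_mono : forall a b c d : gset,
    val a <= val b -> val c <= val d -> val (odot a c) <= val (odot b d) }.

Definition grade0 (R : realType) (V : grades R) : V := [` gset0 V]%fset.
Definition grade1 (R : realType) (V : grades R) : V := [` gset1 V]%fset.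

(* Classical propositional formulas with constants; these are the schemes into
   which basic expressions are substituted. *)
Inductive cform :=
  | CVar of nat | CBot | CTop
  | CAnd of cform & cform | COr of cform & cform | CNeg of cform.

Fixpoint ceval (v : nat -> bool) (t : cform) : bool :=
  match t with
  | CVar n => v n
  | CBot => false
  | CTop => true
  | CAnd s t => ceval v s && ceval v t
  | COr s t => ceval v s || ceval v t
  | CNeg s => ~~ ceval v s
  end.

(* Boolean combinations of atoms in X, without constants. *)
Inductive bform (X : Type) :=
  | FAtom of X
  | FAnd of bform X & bform X | FOr of bform X & bform X | FNeg of bform X.

Definition FImp (X : Type) (s t : bform X) : bform X := FOr (FNeg s) t.
Definition FIff (X : Type) (s t : bform X) : bform X :=
  FAnd (FImp s t) (FImp t s).

Fixpoint beval (X : Type) (v : X -> bool) (t : bform X) : bool :=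
  match t with
  | FAtom x => v x
  | FAnd s t => beval v s && beval v t
  | FOr s t => beval v s || beval v t
  | FNeg s => ~~ beval v s
  end.

Fixpoint bmap (X Y : Type) (f : X -> Y) (t : bform X) : bform Y :=
  match t with
  | FAtom x => FAtom (f x)
  | FAnd s t => FAnd (bmap f s) (bmap f t)
  | FOr s t => FOr (bmap f s) (bmap f t)
  | FNeg s => FNeg (bmap f s)
  end.

Section Syntax.
Variables (R : realType) (V : grades R).
Variables (M : nat) (Ns : 'I_M -> nat) (N : nat).

(* A sorted variable is a pair of its sort i and its rank among the Ns i
   variables of that sort. *)
Definition svar : finType := {i : 'I_M & 'I_(Ns i)}.
Definition var : finType := (svar + 'I_N)%type.

Inductive bexp :=
  | BVar of var | BBot | BTop
  | BAnd of bexp & bexp | BOr of bexp & bexp | BNeg of bexp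
  | BLe of bexp | BGe of bexp.

Fixpoint csubst (s : nat -> bexp) (t : cform) : bexp :=
  match t with
  | CVar n => s n
  | CBot => BBot
  | CTop => BTop
  | CAnd t u => BAnd (csubst s t) (csubst s u)
  | COr t u => BOr (csubst s t) (csubst s u)
  | CNeg t => BNeg (csubst s t)
  end.

(* Variable occurrences, with multiplicity. *)
Fixpoint bvars (phi : bexp) : seq var :=
  match phi with
  | BVar x => [:: x]
  | BBot | BTop => [::]
  | BAnd phi psi | BOr phi psi => bvars phi ++ bvars psi
  | BNeg phi | BLe phi | BGe phi => bvars phi
  end.

Definition var_sort (x : var) : option 'I_M :=
  if x is inl p then Some (tag p) else None.

Definition of_sort (i : 'I_M) (phi : bexp) : bool :=
  all (fun x => var_sort x == Some i) (bvars phi).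

Definition one_sorted (phi : bexp) : Prop := exists i, of_sort i phi.

Definition disjoint_sorted (phi psi : bexp) : Prop :=
  (forall x, x \in bvars phi ++ bvars psi -> var_sort x != None) /\
  (forall x y, x \in bvars phi -> y \in bvars psi -> var_sort x != var_sort y).

Definition literal (phi : bexp) : bool :=
  match phi with BVar _ | BNeg (BVar _) => true | _ => false end.

Definition diamond (phi : bexp) : bool :=
  match phi with BLe _ | BGe _ => true | _ => false end.

(* Conjunctions, bracketed arbitrarily; BTop is the empty conjunction, which is
   the only m.e.c. candidate when there is no variable to list. *)
Inductive conj_of (P : pred bexp) : bexp -> Prop :=
  | conj_top : conj_of P BTop
  | conj_base phi : P phi -> conj_of P phi
  | conj_and phi psi : conj_of P phi -> conj_of P psi -> conj_of P (BAnd phi psi).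

Definition mec (eps : bexp) : Prop :=
  conj_of literal eps /\
  forall p : svar, count_mem (inl p : var) (bvars eps) = 1%N.

Definition one_sorted_mec (i : 'I_M) (eps : bexp) : Prop :=
  [/\ conj_of literal eps, of_sort i eps &
      forall p : svar, tag p = i -> count_mem (inl p : var) (bvars eps) = 1%N].

Record gimp := GImp { ante : bexp; degree : V; conseq : bexp }.

Definition formula : Type := bform gimp.

End Syntax.

Arguments BVar {M Ns N}.
Arguments BBot {M Ns N}.
Arguments BTop {M Ns N}.

Notation "phi =[ c ]=> psi" := (FAtom (GImp phi c psi))
  (at level 70, c at level 60, no associativity).

Section ProofSystem.
Variables (R : realType) (V : grades R).
Variables (M : nat) (Ns : 'I_M -> nat) (N : nat).

Notation bexp := (bexp Ns N).
Notation formula := (formula V Ns N).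
Notation "'1g'" := (grade1 V).
Notation "'0g'" := (grade0 V).

Inductive axiom : formula -> Prop :=
  | A1 (s : nat -> bexp) (p q : cform) :
      (forall v, ceval v p ==> ceval v q) ->
      axiom (csubst s p =[ 1g ]=> csubst s q)
  | A2 (phi psi : bexp) :
      axiom (FImp (phi =[ 1g ]=> psi) (BAnd phi (BNeg psi) =[ 1g ]=> BBot))
  | A3 (phi psi : bexp) (c d : V) : val d <= val c ->
      axiom (FImp (phi =[ c ]=> psi) (phi =[ d ]=> psi))
  | A4 (phi psi : bexp) :
      axiom (FImp (FNeg (psi =[ 1g ]=> BBot)) (phi =[ 0g ]=> psi))
  | A5 (phi : bexp) (c : V) :
      axiom (FImp (phi =[ c ]=> BBot) (phi =[ 1g ]=> BBot))
  | A6 (del eps : bexp) (c : V) : mec del -> mec eps ->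
      axiom (FImp (FAnd (FNeg (del =[ 1g ]=> BBot)) (del =[ c ]=> eps))
                  (eps =[ c ]=> del))
  | A7 (phi psi chi : bexp) (c : V) :
      axiom (FImp (FAnd (phi =[ c ]=> chi) (psi =[ c ]=> chi))
                  (BOr phi psi =[ c ]=> chi))
  | A8 (eps phi psi : bexp) (c : V) : mec eps ->
      axiom (FImp (eps =[ c ]=> BOr phi psi)
                  (FOr (eps =[ c ]=> phi) (eps =[ c ]=> psi)))
  | A9 (phi psi chi : bexp) (c d : V) :
      axiom (FImp (FAnd (phi =[ c ]=> psi) (psi =[ d ]=> chi))
                  (phi =[ odot c d ]=> chi))
  | A10 : axiom (FNeg (BTop =[ 1g ]=> BBot))
  | A11 (s : nat -> gimp V Ns N) (t : bform nat) :
      (forall v, beval v t) -> axiom (bmap s t)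
  | A12_le (phi : bexp) : axiom (phi =[ 1g ]=> BLe phi)
  | A12_ge (phi : bexp) : axiom (phi =[ 1g ]=> BGe phi)
  | A13_le (phi : bexp) : axiom (BLe (BLe phi) =[ 1g ]=> BLe phi)
  | A13_ge (phi : bexp) : axiom (BGe (BGe phi) =[ 1g ]=> BGe phi)
  | A14_le : axiom (BLe BBot =[ 1g ]=> BBot)
  | A14_ge : axiom (BGe BBot =[ 1g ]=> BBot)
  | A15_le (i : 'I_M) (phi psi : bexp) : of_sort i phi -> of_sort i psi ->
      axiom (FOr (BLe phi =[ 1g ]=> BLe psi) (BLe psi =[ 1g ]=> BLe phi))
  | A15_ge (i : 'I_M) (phi psi : bexp) : of_sort i phi -> of_sort i psi ->
      axiom (FOr (BGe phi =[ 1g ]=> BGe psi) (BGe psi =[ 1g ]=> BGe phi))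
  | A16 (i : 'I_M) (eps : bexp) : one_sorted_mec i eps ->
      axiom (BAnd (BLe eps) (BGe eps) =[ 1g ]=> eps)
  | A17_le (phi psi : bexp) (c : V) :
      axiom (FImp (phi =[ c ]=> psi) (BLe phi =[ c ]=> BLe psi))
  | A17_ge (phi psi : bexp) (c : V) :
      axiom (FImp (phi =[ c ]=> psi) (BGe phi =[ c ]=> BGe psi))
  | A18_le (phi psi : bexp) : one_sorted phi ->
      axiom (FImp (BAnd phi (BLe psi) =[ 1g ]=> BBot)
                  (BAnd (BGe phi) (BLe psi) =[ 1g ]=> BBot))
  | A18_ge (phi psi : bexp) : one_sorted phi ->
      axiom (FImp (BAnd phi (BGe psi) =[ 1g ]=> BBot)
                  (BAnd (BLe phi) (BGe psi) =[ 1g ]=> BBot))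
  | A19 (phi rho sig : bexp) (c : V) :
      conj_of (@diamond M Ns N) rho -> conj_of (@diamond M Ns N) sig ->
      axiom (FImp (FAnd (FAnd (FNeg (BAnd rho sig =[ 1g ]=> BBot))
                              (phi =[ c ]=> rho))
                        (phi =[ c ]=> sig))
                  (phi =[ c ]=> BAnd rho sig))
  | A20 (phi phi' psi psi' : bexp) (c : V) :
      disjoint_sorted (BAnd phi psi) (BAnd phi' psi') ->
      axiom (FImp (FNeg (BAnd phi phi' =[ 1g ]=> BBot))
                  (FIff (FAnd (phi =[ c ]=> psi) (phi' =[ c ]=> psi'))
                        (BAnd phi phi' =[ c ]=> BAnd psi psi')))
  | A21_ge (phi chi psi : bexp) : disjoint_sorted chi psi ->
      axiom (FImp (BAnd (BAnd (BGe phi) chi) psi =[ 1g ]=> BBot)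
                  (FOr (BAnd (BGe phi) chi =[ 1g ]=> BBot)
                       (BAnd (BGe phi) psi =[ 1g ]=> BBot)))
  | A21_le (phi chi psi : bexp) : disjoint_sorted chi psi ->
      axiom (FImp (BAnd (BAnd (BLe phi) chi) psi =[ 1g ]=> BBot)
                  (FOr (BAnd (BLe phi) chi =[ 1g ]=> BBot)
                       (BAnd (BLe phi) psi =[ 1g ]=> BBot)))
  | A22 (eps : bexp) (k : 'I_N) : mec eps ->
      axiom (FOr (eps =[ 1g ]=> BVar (inr k))
                 (eps =[ 1g ]=> BNeg (BVar (inr k)))).

Inductive derivable (T : formula -> Prop) : formula -> Prop :=
  | derivable_hyp Phi : T Phi -> derivable T Phi
  | derivable_ax Phi : axiom Phi -> derivable T Phi
  | derivable_mp Phi Psi :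
      derivable T Phi -> derivable T (FImp Phi Psi) -> derivable T Psi.

End ProofSystem.

Section Semantics.
Variables (R : realType) (V : grades R).

Record is_similarity (W : Type) (S : W -> W -> V) : Prop := {
  sim_nonempty : inhabited W;
  sim_eq1 : forall u v, S u v = grade1 V <-> u = v;
  sim_sym : forall u v, S u v = S v u;
  sim_trans : forall u v w, val (odot (S u v) (S v w)) <= val (S u w) }.

Record tosspace := TOSSpace {
  tosspace_car :> finType;
  tsim : tosspace_car -> tosspace_car -> V;
  tole : rel tosspace_car;
  tsim_sim : is_similarity tsim;
  tole_refl : reflexive tole;
  tole_anti : antisymmetric tole;
  tole_trans : transitive tole;
  tole_total : total tole;
  tole_sim : forall u v w, tole u v -> tole v w ->
    val (tsim u w) <= Num.min (val (tsim u v)) (val (tsim v w)) }.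

Section ComponentWise.
Variables (M : nat) (W : 'I_M -> tosspace).

Definition world : finType := {dffun forall i : 'I_M, W i}.

Definition cole (i : 'I_M) (v w : world) : bool := tole (v i) (w i).

(* The unit 1 of the iterated minimum is the largest grade, so for M > 0 this
   is the minimum of the componentwise similarities. *)
Definition wsim (v w : world) : R :=
  \big[Num.min/1]_(i < M) val (tsim (v i) (w i)).

Definition dia_le (A : {set world}) : {set world} :=
  [set w | [forall i, [exists v in A, cole i w v]]].

Definition dia_ge (A : {set world}) : {set world} :=
  [set w | [forall i, [exists v in A, cole i v w]]].

Definition nbh (c : V) (A : {set world}) : {set world} :=
  [set w | [exists a in A, val c <= wsim w a]].

Definition cylinder (i : 'I_M) (C : {set W i}) : {set world} :=
  [set w : world | w i \in C].

Variables (Ns : 'I_M -> nat) (N : nat).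

Definition eval_slit (e : bexp Ns N -> {set world}) (l : svar Ns * bool) :
    {set world} :=
  if l.2 then e (BVar (inl l.1)) else ~: e (BVar (inl l.1)).

Record is_evaluation (e : bexp Ns N -> {set world}) : Prop := {
  ev_and : forall phi psi, e (BAnd phi psi) = e phi :&: e psi;
  ev_or : forall phi psi, e (BOr phi psi) = e phi :|: e psi;
  ev_neg : forall phi, e (BNeg phi) = ~: e phi;
  ev_bot : e BBot = set0;
  ev_top : e BTop = [set: world];
  ev_sep : forall v w : world, v <> w ->
    exists x : var Ns N, (v \in e (BVar x)) != (w \in e (BVar x));
  ev_sorted : forall p : svar Ns,
    exists A : {set W (tag p)}, e (BVar (inl p)) = cylinder A;
  ev_unsorted : forall k : 'I_N, exists K : {set {set svar Ns * bool}},
    e (BVar (inr k)) = (\bigcup_(L in K) \bigcap_(l in L) eval_slit e l)%SET;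
  ev_le : forall phi, e (BLe phi) = dia_le (e phi);
  ev_ge : forall phi, e (BGe phi) = dia_ge (e phi) }.

Definition sat_gimp (e : bexp Ns N -> {set world}) (g : gimp V Ns N) : bool :=
  e (ante g) \subset nbh (degree g) (e (conseq g)).

Definition satisfies (e : bexp Ns N -> {set world}) (Phi : formula V Ns N) :
    bool :=
  beval (sat_gimp e) Phi.

End ComponentWise.

Definition entails (M : nat) (Ns : 'I_M -> nat) (N : nat)
    (T : formula V Ns N -> Prop) (Phi : formula V Ns N) : Prop :=
  forall (W : 'I_M -> tosspace) (e : bexp Ns N -> {set world W}),
    is_evaluation e ->
    (forall Psi, T Psi -> satisfies e Psi) -> satisfies e Phi.

End Semantics.

(* Main.v *)
(* Completeness.  By Zorn's lemma a theory that does not derive Phi is contained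
   in one maximal with that property, that is, in the set of formulas true under
   a valuation mu of the graded implications; mu makes all axioms true.  Let W_i
   be the set of one-sorted m.e.c.'s of sort i that are consistent under mu,
   ordered by a <= b iff a =>1 <>le b, with S_i(a, b) the largest c such that
   a =>c b.  By A21 the product of the W_i is exactly the set of consistent full
   m.e.c.'s; A20 transfers A6 and A8 from full to one-sorted m.e.c.'s; A18 makes
   a =>1 <>le b equivalent to b =>1 <>ge a.  Sending phi to the set of consistent
   m.e.c.'s below it is then an evaluation satisfying exactly the graded
   implications true under mu.

   Soundness.  Two closure properties of sets of worlds suffice: the value of an
   expression depends only on the coordinates of the sorts of its variables, and
   the value of a conjunction of diamonds is a product of order-convex sets. *)
From mathcomp Require Import boolp classical_sets.
From mathcomp Require Import all_boot all_order all_algebra.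
From mathcomp Require Import finmap reals.
Require Import Defs.

Set Implicit Arguments.
Unset Strict Implicit.
Unset Printing Implicit Defensive.

Import Order.TTheory GRing.Theory Num.Theory.
Local Open Scope ring_scope.

(** * Maximal theories *)

Section BooleanCombinations.

Lemma beval_imp X (v : X -> bool) s t :
  beval v (FImp s t) = (beval v s ==> beval v t).
Proof. by rewrite /= implybE. Qed.

Lemma beval_iff X (v : X -> bool) s t :
  beval v (FIff s t) = (beval v s == beval v t).
Proof. by rewrite /=; case: (beval v s); case: (beval v t). Qed.

Lemma eq_beval X (v w : X -> bool) t : v =1 w -> beval v t = beval w t.
Proof. by move=> vw; elim: t => //= [s -> t ->|s -> t ->|s ->]. Qed.

Lemma beval_bmap X Y (f : X -> Y) v t : beval v (bmap f t) = beval (v \o f) t.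
Proof. by elim: t => //= [s -> t ->|s -> t ->|s ->]. Qed.

Fixpoint batoms X (t : bform X) : seq X :=
  match t with
  | FAtom x => [:: x]
  | FAnd s t | FOr s t => batoms s ++ batoms t
  | FNeg s => batoms s
  end.

Lemma bmap_id_in (X : eqType) (f : X -> X) (t : bform X) :
  {in batoms t, f =1 id} -> bmap f t = t.
Proof.
elim: t => /= [x|s IHs t IHt|s IHs t IHt|s IHs] h.
- by rewrite h ?inE.
- by rewrite IHs ?IHt // => x hx; apply: h; rewrite mem_cat hx ?orbT.
- by rewrite IHs ?IHt // => x hx; apply: h; rewrite mem_cat hx ?orbT.
- by rewrite IHs.
Qed.

Lemma bmap_comp X Y Z (f : X -> Y) (g : Y -> Z) t :
  bmap g (bmap f t) = bmap (g \o f) t.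
Proof. by elim: t => //= [s -> t ->|s -> t ->|s ->]. Qed.

End BooleanCombinations.

Section Lindenbaum.
Variables (R : realType) (V : grades R).
Variables (M : nat) (Ns : 'I_M -> nat) (N : nat).

Notation formula := (formula V Ns N).
Implicit Types (T G : formula -> Prop) (A B Phi : formula).

(** [A11] substitutes into schemes with numbered atoms, so the atoms of [A] are numbered by their
    first position in [l]; [{classic _}] supplies the equality test that this needs. *)
Lemma axiom_taut A : (forall v, beval v A) -> axiom A.
Proof.
move=> tA; pose X : eqType := {classic gimp V Ns N}.
pose l : seq X := batoms A.
pose x0 : X := GImp BBot (grade0 V) BBot.
have -> : A = bmap (nth x0 l) (bmap (fun x : X => index x l) A).
  rewrite bmap_comp [RHS](@bmap_id_in X) // => x hx /=.
  exact: (@nth_index X).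
by apply: A11 => v; rewrite beval_bmap.
Qed.

Lemma derivable_taut T A : (forall v, beval v A) -> derivable T A.
Proof. by move=> tA; apply/derivable_ax/axiom_taut. Qed.

Lemma derivable_sub T G A :
  (forall B, T B -> G B) -> derivable T A -> derivable G A.
Proof.
move=> TG; elim=> [B /TG|B|B C _ hB _]; [exact: derivable_hyp|exact: derivable_ax|].
exact: derivable_mp.
Qed.

Lemma deduction T A Phi :
  derivable (fun B => T B \/ B = A) Phi -> derivable T (FImp A Phi).
Proof.
elim=> [B [TB|->]|B axB|B C _ IHB _ IHBC].
- apply: (derivable_mp (derivable_hyp TB)).
  by apply: derivable_taut => v; rewrite !beval_imp; do 2!case: beval.
- by apply: derivable_taut => v; rewrite beval_imp; case: beval.
- apply: (derivable_mp (derivable_ax _ axB)).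
  by apply: derivable_taut => v; rewrite !beval_imp; do 2!case: beval.
- apply: (derivable_mp IHBC); apply: (derivable_mp IHB).
  by apply: derivable_taut => v; rewrite !beval_imp; do 3!case: beval.
Qed.

(** At each modus ponens the larger of two members of the chain serves both premises. The
    alternative [derivable T Phi] covers derivations that use no member, as when [F] is empty. *)
Lemma derivable_bigcup T (F : set (set formula)) Phi :
  total_on F classical_sets.subset ->
  derivable (fun A => T A \/ (\bigcup_(G in F) G)%classic A) Phi ->
  derivable T Phi \/
  exists2 G, F G & derivable (fun A => T A \/ G A) Phi.
Proof.
move=> totF; elim=> [B [TB|[G FG GB]]|B axB|B C _ IHB _ IHBC].
- by left; apply: derivable_hyp.
- by right; exists G => //; apply: derivable_hyp; right.
- by left; apply: derivable_ax.
- have inl G A : derivable T A -> derivable (fun A => T A \/ G A) A.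
    by apply: derivable_sub => D; left.
  case: IHB IHBC => [dB|[G FG dB]] [dBC|[H FH dBC]].
  + by left; apply: derivable_mp dBC.
  + by right; exists H => //; apply: (derivable_mp (inl _ _ dB)).
  + by right; exists G => //; apply: (derivable_mp dB); apply: inl.
  + case: (totF _ _ FG FH) => sub; right; [exists H|exists G] => //.
      apply: derivable_mp dBC; apply: derivable_sub dB => D [|/sub]; by [left|right].
    apply: (derivable_mp dB); apply: derivable_sub dBC => D [|/sub]; by [left|right].
Qed.

Lemma lindenbaum T Phi : ~ derivable T Phi ->
  exists mu : gimp V Ns N -> bool,
    [/\ forall A, axiom A -> beval mu A, forall A, T A -> beval mu A
      & ~~ beval mu Phi].
Proof.
move=> nPhi.
pose P : set (set formula) := fun G => ~ derivable (fun A => T A \/ G A) Phi.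
have [F FP totF|G [PG maxG]] := @Zorn_bigcup _ P.
  by move=> /(derivable_bigcup totF)[//|[G /FP]].
pose D := derivable (fun A => T A \/ G A).
(* By maximality, adding a formula outside [G] makes [Phi] derivable; the deduction theorem turns
   this into an implication. *)
have Gmax A : ~ G A -> D (FImp A Phi).
  move=> nGA; apply: deduction.
  apply: (@derivable_sub (fun B => T B \/ (G B \/ B = A))) => [B|].
    by case=> [|[]]; [left; left|left; right|right].
  apply: contrapT => nd; apply: (maxG (fun B => G B \/ B = A)) => //.
  by split=> [B|sub]; [left|apply: nGA; apply: sub; right].
have Gcl A : D A -> G A.
  move=> DA; apply: contrapT => /Gmax dA; apply: PG; exact: derivable_mp dA.
have GD A : G A -> D A by move=> GA; apply: derivable_hyp; right.
have Gneg A : G (FNeg A) <-> ~ G A.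
  split=> [GnA GA|nGA].
    apply: PG; apply: (derivable_mp (GD _ GA)); apply: (derivable_mp (GD _ GnA)).
    by apply: derivable_taut => v; rewrite !beval_imp /=; do 2!case: beval.
  (* If both [A] and its negation were missing, each would imply [Phi], and excluded middle would
     derive [Phi]. *)
  apply: contrapT => nGnA; apply: PG.
  apply: (derivable_mp (Gmax _ nGnA)); apply: (derivable_mp (Gmax _ nGA)).
  by apply: derivable_taut => v; rewrite !beval_imp /=; do 2!case: beval.
have Gand A B : G (FAnd A B) <-> G A /\ G B.
  split=> [/GD dAB|[/GD dA /GD dB]].
    split; apply: Gcl; apply: (derivable_mp dAB);
    by apply: derivable_taut => v; rewrite !beval_imp /=; do 2!case: beval.
  apply: Gcl; apply: (derivable_mp dB); apply: (derivable_mp dA).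
  by apply: derivable_taut => v; rewrite !beval_imp /=; do 2!case: beval.
have Gor A B : G (FOr A B) <-> G A \/ G B.
  split=> [/GD dAB|].
    apply: contrapT => /not_orP[/Gneg/GD dA /Gneg/GD dB].
    suff /Gneg : G (FNeg (FOr A B)) by apply; apply: Gcl.
    apply: Gcl; apply: (derivable_mp dB); apply: (derivable_mp dA).
    by apply: derivable_taut => v; rewrite !beval_imp /=; do 2!case: beval.
  by case=> /GD dA; apply: Gcl; apply: (derivable_mp dA);
    apply: derivable_taut => v; rewrite !beval_imp /=; do 2!case: beval.
exists (fun g => `[< G (FAtom g) >]).
have truth A : beval (fun g => `[< G (FAtom g) >]) A <-> G A.
  elim: A => /= [g|A IHA B IHB|A IHA B IHB|A IHA].
  - by split=> /asboolP.
  - by rewrite Gand -IHA -IHB; split=> [/andP|[-> ->]].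
  - by rewrite Gor -IHA -IHB; split=> [/orP|[]->]; rewrite ?orbT.
  - by rewrite Gneg -IHA; split=> [/negP|/negP].
split=> [A axA|A TA|].
- by apply/truth; apply: Gcl; apply: derivable_ax.
- by apply/truth; apply: Gcl; apply: derivable_hyp; left.
- by apply/negP => /truth/GD.
Qed.

End Lindenbaum.

(** * Soundness *)

Section Grades.
Variables (R : realType) (V : grades R).

Lemma grade_le1 (c : V) : val c <= 1.
Proof. by case/andP: (gset_itv (valP c)). Qed.

Lemma grade_ge0 (c : V) : 0 <= val c.
Proof. by case/andP: (gset_itv (valP c)). Qed.

Lemma odotg1 (c : V) : odot c (grade1 V) = c.
Proof. by rewrite odotC odot1. Qed.

End Grades.

(** * Convexity in a single chain *)

Section Chain.
Variables (R : realType) (V : grades R) (X : tosspace V).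
Implicit Types (b : bool) (c : V) (x y z : X).

Definition near c x y : bool := val c <= val (tsim x y).

Lemma near_refl c x : near c x x.
Proof. by rewrite /near (sim_eq1 (tsim_sim X) x x).2 // grade_le1. Qed.

Lemma near_sym c x y : near c x y = near c y x.
Proof. by rewrite /near (sim_sym (tsim_sim X)). Qed.

Lemma near1 x y : near (grade1 V) x y -> x = y.
Proof.
move=> h; apply/(sim_eq1 (tsim_sim X)); apply/val_inj/le_anti.
by rewrite grade_le1.
Qed.

Lemma near0 x y : near (grade0 V) x y.
Proof. exact: grade_ge0. Qed.

Lemma near_trans c d x y z : near c x y -> near d y z -> near (odot c d) x z.
Proof.
by move=> cd de; apply: le_trans (sim_trans (tsim_sim X) x y z); apply: odot_mono.
Qed.

(* [ord true] is the order of the chain and [ord false] its converse, so that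
   both diamonds are instances of one operator. *)
Definition ord b x y := if b then tole x y else tole y x.

Lemma ord_refl b x : ord b x x.
Proof. by case: b; apply: tole_refl. Qed.

Lemma ord_trans b x y z : ord b x y -> ord b y z -> ord b x z.
Proof. by case: b => /= xy yz; [apply: tole_trans yz|apply: (tole_trans yz)]. Qed.

Lemma ord_anti b x y : ord b x y -> ord b y x -> x = y.
Proof. by move=> xy yx; apply: tole_anti; case: b xy yx => /= -> ->. Qed.

Lemma ord_negb b x y : ord (~~ b) x y = ord b y x.
Proof. by case: b. Qed.

Lemma ord_total b x y : ord b x y || ord b y x.
Proof. by case: b => /=; have := tole_total x y; rewrite // orbC. Qed.

Lemma ord_near b c x y z : ord b x y -> ord b y z -> near c x z ->
  near c x y /\ near c y z.
Proof.
(* Reversing the order exchanges the endpoints, which the symmetry of [near] absorbs. *)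
wlog ->: b x z / b = true => [gen|].
  case: b => [|/= yx zy]; first exact: (gen true).
  rewrite near_sym => /(gen true z x erefl zy yx).
  by rewrite -(near_sym c x) (near_sym c z) => -[].
move=> xy yz cxz; have := tole_sim xy yz.
by rewrite le_min => /andP[h1 h2]; split; apply: le_trans cxz _.
Qed.

(** One coordinate of [A17]. If [x] is not beyond [z], then [u] is [x] itself; otherwise [z], [x],
    [y] lie in this order and convexity puts [x] within [c] of [z]. *)
Lemma near_below b c x y z : ord b x y -> near c y z ->
  exists u, ord b u z /\ near c x u.
Proof.
move=> xy cyz; case/orP: (ord_total b x z) => [xz|zx].
  by exists x; rewrite near_refl.
exists z; rewrite ord_refl near_sym; split=> //.
by rewrite near_sym in cyz; case: (ord_near zx xy cyz).
Qed.

(* The witness is [m] if [r] or [s] lies beyond it, else the largest of [x], [r]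
   and [s] in the direction of [m]. *)
Lemma near_hull c x r s m : near c x r -> near c x s ->
  exists t, [/\ exists b, ord b r t /\ ord b t m,
                exists b, ord b s t /\ ord b t m & near c x t].
Proof.
move=> cxr cxs.
have [b xm] : exists b, ord b x m.
  by case/orP: (tole_total x m) => h; [exists true|exists false].
have far y : near c x y -> ord b m y -> near c x m.
  by move=> cxy my; case: (ord_near xm my cxy).
have atm : near c x m -> exists t, [/\ exists b, ord b r t /\ ord b t m,
                exists b, ord b s t /\ ord b t m & near c x t].
  move=> cxm; exists m; split=> //.
    by case/orP: (ord_total true r m) => h; [exists true|exists false];
      rewrite ord_refl.
  by case/orP: (ord_total true s m) => h; [exists true|exists false];
    rewrite ord_refl.
case/orP: (ord_total b r m) => rm; last exact: atm (far _ cxr rm).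
case/orP: (ord_total b s m) => sm; last exact: atm (far _ cxs sm).
suff [t [rt st tm cxt]] :
    exists t, [/\ ord b r t, ord b s t, ord b t m & near c x t].
  by exists t; split=> //; exists b.
case/orP: (ord_total b r s) => [rs|sr].
  case/orP: (ord_total b s x) => [sx|xs].
    by exists x; rewrite near_refl (ord_trans rs sx).
  by exists s; rewrite ord_refl.
case/orP: (ord_total b r x) => [rx|xr].
  by exists x; rewrite near_refl (ord_trans sr rx).
by exists r; rewrite ord_refl.
Qed.

End Chain.

(** * Diamonds and neighbourhoods in a product of chains *)

Section Worlds.
Variables (R : realType) (V : grades R) (M : nat) (W : 'I_M -> tosspace V).
Notation world := (world W).
Implicit Types (A B : {set world}) (v w : world) (I : pred 'I_M) (b : bool).

(** Unfolds to [dia_le] for [true] and to [dia_ge] for [false]. *)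
Definition dia b A : {set world} :=
  [set w : world | [forall i, [exists v : world in A, ord b (w i) (v i)]]].

Lemma diaP b A w :
  reflect (forall i, exists2 v : world, v \in A & ord b (w i) (v i)) (w \in dia b A).
Proof.
rewrite inE; apply: (iffP forallP) => h i.
  by have /exists_inP := h i.
by apply/exists_inP; apply: h.
Qed.

Lemma wsim_near c v w :
  reflect (forall i, near c (v i) (w i)) (val c <= wsim v w).
Proof.
apply: (iffP idP) => [h i|h].
  by apply: le_trans h _; rewrite /wsim (bigD1 i) //= ge_min lexx.
by rewrite /wsim; apply: le_bigmin => [|i _]; [apply: grade_le1|apply: h].
Qed.

Lemma nbhP c A w :
  reflect (exists2 a : world, a \in A & forall i, near c (w i) (a i))
          (w \in nbh c A).
Proof.
rewrite inE; apply: (iffP exists_inP) => -[a aA h]; exists a => //;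
  exact/wsim_near.
Qed.

Lemma nbh1 A : nbh (grade1 V) A = A.
Proof.
apply/setP => w; apply/nbhP/idP => [[a aA h]|wA].
  suff -> : w = a by [].
  by apply/ffunP => i; apply: near1.
by exists w => // i; apply: near_refl.
Qed.

Definition mix I v w : world := [ffun i => if I i then v i else w i].

Lemma mixE I v w i : mix I v w i = if I i then v i else w i.
Proof. by rewrite ffunE. Qed.

(** Being a cylinder over the coordinates in [I], phrased as an invariance so that no projection of
    [A] is needed. *)
Definition determined I A :=
  forall v w, (forall i, I i -> v i = w i) -> v \in A -> w \in A.

Lemma determined_mixl I A v w : determined I A -> v \in A -> mix I v w \in A.
Proof. by move=> detA; apply: detA => i Ii; rewrite mixE Ii. Qed.

Lemma determined_mixr I A v w :
  determined (predC I) A -> w \in A -> mix I v w \in A.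
Proof. by move=> detA; apply: detA => i /negbTE Ii; rewrite mixE Ii. Qed.

Lemma determined_dia I b A : determined I A -> determined I (dia b A).
Proof.
move=> detA v w vw /diaP vA; apply/diaP => i.
have [x xA vx] := vA i; case Ii: (I i); first by exists x; rewrite // -vw.
(* Outside [I] the witness may copy [w], where the order condition is reflexivity. *)
exists (mix I x w); first exact: determined_mixl.
by rewrite mixE Ii ord_refl.
Qed.

(** Membership in a diamond is tested coordinate by coordinate, so a diamond is a product set. [A21]
    rests on this. *)
Lemma dia_mix I b A v w :
  v \in dia b A -> w \in dia b A -> mix I v w \in dia b A.
Proof. by move=> /diaP vA /diaP wA; apply/diaP => i; rewrite mixE; case: (I i). Qed.

Lemma dia_sup b A : A \subset dia b A.
Proof. by apply/subsetP => w wA; apply/diaP => i; exists w; rewrite ?ord_refl. Qed.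

Lemma dia_dia b A : dia b (dia b A) \subset dia b A.
Proof.
apply/subsetP => w /diaP wA; apply/diaP => i.
have [v /diaP/(_ i)[u uA vu] wv] := wA i.
by exists u; rewrite // (ord_trans wv).
Qed.

Lemma dia_down b A v w :
  (forall i, ord b (v i) (w i)) -> w \in dia b A -> v \in dia b A.
Proof.
move=> vw /diaP wA; apply/diaP => i; have [u uA wu] := wA i.
by exists u; rewrite // (ord_trans (vw i)).
Qed.

Lemma dia_determined1 i b A w : determined (pred1 i) A ->
  reflect (exists2 v : world, v \in A & ord b (w i) (v i)) (w \in dia b A).
Proof.
move=> detA; apply: (iffP (diaP _ _ _)) => [/(_ i)//|[v vA wv] j].
have [->|ji] := eqVneq j i; first by exists v.
by exists (mix (pred1 i) v w); rewrite ?determined_mixl // mixE /= (negbTE ji)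
  ord_refl.
Qed.

(** Apply [near_below] at each coordinate and assemble the points found. They may come from
    different members of [B], which the diamond of [B] tolerates. *)
Lemma dia_mono_near b c A B : A \subset nbh c B -> dia b A \subset nbh c (dia b B).
Proof.
move=> /subsetP AB; apply/subsetP => w /diaP wA; apply/nbhP.
have /fin_all_exists[u hu] i : exists u : W i,
    (exists2 v : world, v \in B & ord b u (v i)) /\ near c (w i) u.
  have [v vA wv] := wA i; have /nbhP[x xB vx] := AB _ vA.
  by have [u [ux wu]] := near_below wv (vx i); exists u; split=> //; exists x.
exists [ffun i => u i] => [|i]; last by rewrite ffunE; case: (hu i).
by apply/diaP => i; rewrite ffunE; case: (hu i).
Qed.

(** If [u] lies in the first diamond but not in the second, every point of [B] precedes [u] at
    coordinate [i], and [u] precedes some point of [A] there. *)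
Lemma dia_total i b A B : determined (pred1 i) A -> determined (pred1 i) B ->
  (dia b A \subset dia b B) || (dia b B \subset dia b A).
Proof.
move=> dA dB; case: (boolP (_ \subset _)) => //= /subsetPn[u].
move=> /(dia_determined1 _ _ dA)[x xA ux] uB; apply/subsetP => w.
move=> /(dia_determined1 _ _ dB)[y yB wy]; apply/(dia_determined1 _ _ dA).
exists x => //; case/orP: (ord_total b (u i) (y i)) => h.
  by case/(dia_determined1 _ _ dB): uB; exists y.
exact: ord_trans wy (ord_trans h ux).
Qed.

(** Giving [w] the coordinate [i] of [a] puts it into [A] and only moves it down in direction [b],
    so it stays in the diamond of [B]. *)
Lemma dia_disjoint i b A B : determined (pred1 i) A ->
  A :&: dia b B = set0 -> dia (~~ b) A :&: dia b B = set0.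
Proof.
move=> detA AB0; apply/setP => w; rewrite in_set0; apply/negP.
move=> /setIP[/(dia_determined1 _ _ detA)[a aA]]; rewrite ord_negb => aw wB.
have: mix (pred1 i) a w \in A :&: dia b B; last by rewrite AB0 in_set0.
rewrite in_setI determined_mixl //=; apply: dia_down wB => j.
by rewrite mixE /=; case: eqVneq => [->|_] //; rewrite ord_refl.
Qed.

(** A product of order-convex sets, stated without naming the factors: at each coordinate [w] lies
    between values taken on [A], possibly at different points. The direction may vary with the
    coordinate. *)
Definition boxed A := forall w,
  (forall i, exists (u v : world) b, [/\ u \in A, v \in A, ord b (u i) (w i)
    & ord b (w i) (v i)]) -> w \in A.

Lemma boxed_dia b A : boxed (dia b A).
Proof.
move=> w hw; apply/diaP => i; have [u [v [b' [/diaP uA /diaP vA uw wv]]]] := hw i.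
have [x xA ux] := uA i; have [y yA vy] := vA i.
have [bb|/negbTE bb] := eqVneq b' b.
  by exists y; rewrite // (ord_trans _ vy) // -bb.
exists x; rewrite // (ord_trans _ ux) // -ord_negb.
suff -> : ~~ b = b' by [].
by move: bb; case: (b); case: (b').
Qed.

(** The semantic form of [A19]. At each coordinate [near_hull] moves from [r] and from [s] towards
    the common point [m] and meets in a value still near [w]; convexity keeps it in both sets. *)
Lemma boxed_near c A B w : boxed A -> boxed B -> A :&: B != set0 ->
  w \in nbh c A -> w \in nbh c B -> w \in nbh c (A :&: B).
Proof.
move=> boxA boxB /set0Pn[m /setIP[mA mB]] /nbhP[r rA wr] /nbhP[s sB ws].
have /fin_all_exists[t ht] i := near_hull (m i) (wr i) (ws i).
apply/nbhP; exists [ffun i => t i] => [|i]; last by rewrite ffunE; case: (ht i).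
rewrite inE; apply/andP; split; [apply: boxA|apply: boxB] => i; rewrite ffunE.
  by have [[b [rt tm]] _ _] := ht i; exists r, m, b.
by have [_ [b [rt tm]] _] := ht i; exists s, m, b.
Qed.

End Worlds.

(** * Sorts of an expression as sets of coordinates *)

Section SortSets.
Variables (M : nat) (Ns : 'I_M -> nat) (N : nat).
Implicit Types (phi psi : bexp Ns N) (I : pred 'I_M).

Definition vars_in I phi : bool :=
  all (fun x => if var_sort x is Some i then I i else false) (bvars phi).

Lemma of_sort_vars_in i phi : of_sort i phi = vars_in (pred1 i) phi.
Proof. by apply: eq_all => x; case: (var_sort x). Qed.

(** Replaces the pairwise condition by one splitting of the sorts, the form used by [mix]; [I]
    collects the sorts that occur in [phi]. *)
Lemma disjoint_sortedP phi psi : disjoint_sorted phi psi <->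
  exists I, vars_in I phi /\ vars_in (predC I) psi.
Proof.
split=> [[srt dis]|[I [/allP hI /allP hJ]]].
  exists (fun i => has (fun x => var_sort x == Some i) (bvars phi)).
  split; apply/allP => x hx.
    have := srt x; rewrite mem_cat hx => /(_ isT).
    by case E: (var_sort x) => [i|//] _; apply/hasP; exists x; rewrite ?E.
  have := srt x; rewrite mem_cat hx orbT => /(_ isT).
  case E: (var_sort x) => [i|//] _; apply/hasPn => y hy.
  by rewrite -E; apply: dis.
split=> [x|x y /hI + /hJ].
  by rewrite mem_cat => /orP[/hI|/hJ]; case: (var_sort x).
case: (var_sort x) => [i|//] Ii; case: (var_sort y) => [j|//].
by apply: contra => /eqP[<-].
Qed.

Definition BDia (b : bool) phi := if b then BLe phi else BGe phi.

Lemma vars_in_and I phi psi :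
  vars_in I (BAnd phi psi) = vars_in I phi && vars_in I psi.
Proof. exact: all_cat. Qed.

Lemma vars_in_dia I b phi : vars_in I (BDia b phi) = vars_in I phi.
Proof. by case: b. Qed.

End SortSets.

(** * Validity of the axioms *)

Section Soundness.
Variables (R : realType) (V : grades R) (M : nat) (W : 'I_M -> tosspace V).
Variables (Ns : 'I_M -> nat) (N : nat) (e : bexp Ns N -> {set world W}).
Hypothesis ev : is_evaluation e.
Implicit Types (phi psi eps : bexp Ns N) (v w : world W) (I : pred 'I_M).

Lemma ev_dia b phi : e (BDia b phi) = dia b (e phi).
Proof. by case: b; [apply: ev_le|apply: ev_ge]. Qed.

Lemma determined_var (p : svar Ns) :
  determined (pred1 (tag p)) (e (BVar (inl p))).
Proof.
have [A ->] := ev_sorted ev p => v w vw.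
by rewrite !inE vw /=.
Qed.

Lemma determined_eval I phi : vars_in I phi -> determined I (e phi).
Proof.
elim: phi => [x|||phi IHp psi IHq|phi IHp psi IHq|phi IHp|phi IHp|phi IHp] h.
- rewrite /vars_in /= andbT in h; case: x h => //= p Ip v w vw.
  by apply: determined_var => i /eqP->; apply: vw.
- by move=> v w _; rewrite (ev_bot ev) inE.
- by move=> v w _; rewrite (ev_top ev) inE.
- move: h; rewrite /vars_in /= all_cat => /andP[/IHp hp /IHq hq] v w vw.
  by rewrite (ev_and ev) !inE => /andP[/(hp _ _ vw)-> /(hq _ _ vw)->].
- move: h; rewrite /vars_in /= all_cat => /andP[/IHp hp /IHq hq] v w vw.
  by rewrite (ev_or ev) !inE => /orP[/(hp _ _ vw)->|/(hq _ _ vw)->]; rewrite ?orbT.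
- move=> v w vw; rewrite (ev_neg ev) !inE; apply: contra; apply: IHp => // i Ii.
  by rewrite vw.
- by rewrite (ev_le ev); apply: (@determined_dia _ _ _ _ _ true); apply: IHp.
- by rewrite (ev_ge ev); apply: (@determined_dia _ _ _ _ _ false); apply: IHp.
Qed.

(** An unsorted variable denotes a Boolean combination of sorted ones, so it separates no further
    worlds. *)
Lemma sorted_separate v w :
  (forall p, (v \in e (BVar (inl p))) = (w \in e (BVar (inl p)))) -> v = w.
Proof.
move=> vw; apply/eqP; apply: contraT => /eqP /(ev_sep ev)[[p|k]].
  by rewrite vw eqxx.
have [K ->] := ev_unsorted ev k; case/negP; apply/eqP.
by apply/bigcupP/bigcupP => -[L LK /bigcapP h]; exists L => //;
  apply/bigcapP => l /h; rewrite /eval_slit; case: l.2; rewrite ?inE vw.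
Qed.

Lemma literals_agree eps v w x : conj_of (@literal M Ns N) eps ->
  v \in e eps -> w \in e eps -> x \in bvars eps ->
  (v \in e (BVar x)) = (w \in e (BVar x)).
Proof.
elim=> [|phi|phi psi _ IHp _ IHq] //.
  case: phi => //= [y|[]//= y] _; rewrite ?(ev_neg ev) ?inE => vy wy /eqP->.
    by rewrite vy wy.
  by rewrite (negbTE vy) (negbTE wy).
rewrite (ev_and ev) !inE mem_cat => /andP[vp vq] /andP[wp wq] /orP[]; auto.
Qed.

Lemma count_mem1_in (x : var Ns N) s : count_mem x s = 1%N -> x \in s.
Proof. by rewrite -has_pred1 has_count => ->. Qed.

(** The common reason for [A6], [A8] and [A22]: a m.e.c. holds at no more than one world. *)
Lemma mec_singleton eps v w : mec eps -> v \in e eps -> w \in e eps -> v = w.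
Proof.
move=> [lit cnt] ve we; apply: sorted_separate => p.
by apply: literals_agree ve we _ => //; apply: count_mem1_in.
Qed.

Lemma one_sorted_mec_singleton i eps v w : one_sorted_mec i eps ->
  v \in e eps -> w \in e eps -> v i = w i.
Proof.
(* Copying coordinate [i] of [v] into [w] changes no sorted variable: those of sort [i] are fixed by
   [eps], and the others do not depend on that coordinate. *)
move=> [lit _ cnt] ve we; suff <- : mix (pred1 i) v w = w by rewrite mixE /= eqxx.
apply: sorted_separate => p; have dp := @determined_var p.
have [pi|pi] := eqVneq (tag p) i.
  rewrite -(literals_agree lit ve we (count_mem1_in (cnt p pi))).
  by apply/idP/idP; apply: dp => j /eqP->; rewrite mixE /= pi eqxx.
by apply/idP/idP; apply: dp => j /eqP->; rewrite mixE /= (negbTE pi).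
Qed.

Lemma boxed_diamonds rho : conj_of (@diamond M Ns N) rho -> boxed (e rho).
Proof.
elim=> [|phi|phi psi _ IHp _ IHq].
- by move=> w _; rewrite (ev_top ev) inE.
- by case: phi => // phi _; [rewrite (ev_dia true)|rewrite (ev_dia false)];
    apply: boxed_dia.
- rewrite (ev_and ev) => w hw; rewrite inE IHp ?IHq // => i;
  by have [u [v [b []]]] := hw i; rewrite !inE => /andP[? ?] /andP[? ?];
    exists u, v, b.
Qed.

Lemma sat_imp A B :
  satisfies e (FImp A B : formula V Ns N) = (satisfies e A ==> satisfies e B).
Proof. exact: beval_imp. Qed.

Lemma sat_or A B :
  satisfies e (FOr A B : formula V Ns N) = satisfies e A || satisfies e B.
Proof. by []. Qed.

Lemma sat_and A B :
  satisfies e (FAnd A B : formula V Ns N) = satisfies e A && satisfies e B.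
Proof. by []. Qed.

Lemma sat_neg A : satisfies e (FNeg A : formula V Ns N) = ~~ satisfies e A.
Proof. by []. Qed.

Lemma sat1 phi psi :
  satisfies e (phi =[ grade1 V ]=> psi) = (e phi \subset e psi).
Proof. by rewrite /satisfies /= /sat_gimp /= nbh1. Qed.

Lemma satP c phi psi :
  reflect (forall w, w \in e phi -> w \in nbh c (e psi))
          (satisfies e (phi =[ c ]=> psi)).
Proof. exact: subsetP. Qed.

Lemma sat_bot c phi : satisfies e (phi =[ c ]=> BBot) = (e phi == set0).
Proof.
rewrite -subset0 /satisfies /= /sat_gimp /= (_ : nbh c (e BBot) = set0) //.
apply/setP => w; rewrite in_set0; apply/nbhP => -[a].
by rewrite (ev_bot ev) in_set0.
Qed.

Lemma eval_csubst s t w :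
  (w \in e (csubst s t)) = ceval (fun n => w \in e (s n)) t.
Proof.
elim: t => //= [||t <- u <-|t <- u <-|t <-].
- by rewrite (ev_bot ev) inE.
- by rewrite (ev_top ev) inE.
- by rewrite (ev_and ev) inE.
- by rewrite (ev_or ev) inE.
- by rewrite (ev_neg ev) inE.
Qed.

Let sat_dia_imp1 b phi psi :
  (satisfies e (BDia b phi =[ grade1 V ]=> BDia b psi)) =
  (dia b (e phi) \subset dia b (e psi)).
Proof. by rewrite sat1 !ev_dia. Qed.

Let sound_linear b i phi psi : of_sort i phi -> of_sort i psi ->
  satisfies e (FOr (BDia b phi =[ grade1 V ]=> BDia b psi)
                   (BDia b psi =[ grade1 V ]=> BDia b phi)).
Proof.
rewrite !of_sort_vars_in => /determined_eval dp /determined_eval dq.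
have := dia_total b dp dq; rewrite -!sat_dia_imp1; exact.
Qed.

Let sound_dia_near b phi psi c :
  satisfies e (FImp (phi =[ c ]=> psi) (BDia b phi =[ c ]=> BDia b psi)).
Proof.
rewrite sat_imp; apply/implyP; rewrite /satisfies /= /sat_gimp /= !ev_dia.
exact: dia_mono_near.
Qed.

Let sound_disjoint b phi psi : one_sorted phi ->
  satisfies e (FImp (BAnd phi (BDia b psi) =[ grade1 V ]=> BBot)
    (BAnd (BDia (~~ b) phi) (BDia b psi) =[ grade1 V ]=> BBot)).
Proof.
move=> [i]; rewrite of_sort_vars_in => /determined_eval dp.
rewrite sat_imp !sat_bot !(ev_and ev) !ev_dia; apply/implyP => /eqP h.
by apply/eqP; apply: dia_disjoint dp h.
Qed.

Let sound_split b phi chi psi : disjoint_sorted chi psi ->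
  satisfies e
    (FImp (BAnd (BAnd (BDia b phi) chi) psi =[ grade1 V ]=> BBot)
          (FOr (BAnd (BDia b phi) chi =[ grade1 V ]=> BBot)
               (BAnd (BDia b phi) psi =[ grade1 V ]=> BBot))).
Proof.
move=> /disjoint_sortedP[I [/determined_eval dc /determined_eval dp]].
rewrite sat_imp; apply/implyP; rewrite sat_bot => /eqP h.
rewrite sat_or; apply: contraT; rewrite negb_or !sat_bot => /andP[].
move=> /set0Pn[v] + /set0Pn[w]; rewrite !(ev_and ev) !ev_dia in h *.
move=> /setIP[vp vc] /setIP[wp wc]; suff: mix I v w \in set0 by rewrite in_set0.
rewrite -h !in_setI -!andbA; apply/and3P; split.
- exact: dia_mix.
- exact: determined_mixl.
- exact: determined_mixr.
Qed.

Lemma sound_axiom (M0 : (0 < M)%N) A : axiom A -> satisfies e A.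
Proof.
case=> {A}.
- move=> s p q taut; rewrite sat1; apply/subsetP => w.
  by rewrite !eval_csubst; apply/implyP.
- move=> phi psi; rewrite sat_imp sat1 sat_bot (ev_and ev) (ev_neg ev) -subset0.
  by rewrite -setDE -setD_eq0 subset0; apply/implyP.
- move=> phi psi c d dc; rewrite sat_imp; apply/implyP => /satP h; apply/satP => w.
  move=> /h /nbhP[a aA wa]; apply/nbhP; exists a => // i; exact: le_trans (wa i).
- move=> phi psi; rewrite sat_imp; apply/implyP.
  rewrite sat_neg sat_bot => /set0Pn[a aA].
  apply/satP => w _; apply/nbhP; exists a => // i; exact: near0.
- by move=> phi c; rewrite sat_imp !sat_bot implybb.
- move=> del eps c md me; rewrite sat_imp sat_and sat_neg sat_bot.
  apply/implyP => /andP[/set0Pn[d dd] /satP/(_ _ dd)].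
  move=> /nbhP[x xe dx]; apply/satP => w we; apply/nbhP; exists d => // i.
  by rewrite (mec_singleton me we xe) near_sym.
- move=> phi psi chi c; rewrite sat_imp; apply/implyP => /andP[/satP h /satP k].
  by apply/satP => w; rewrite (ev_or ev) inE => /orP[/h|/k].
- move=> eps phi psi c me; rewrite sat_imp; apply/implyP => /satP h.
  have [e0|[w we]] := set_0Vmem (e eps).
    by apply/orP; left; apply/satP => w; rewrite e0 inE.
  have /nbhP[a] := h _ we; rewrite (ev_or ev) inE => aA wa; apply/orP.
  by case/orP: aA => aA; [left|right]; apply/satP => x xe;
    rewrite (mec_singleton me xe we); apply/nbhP; exists a.
- move=> phi psi chi c d; rewrite sat_imp; apply/implyP => /andP[/satP h /satP k].
  apply/satP => w /h /nbhP[x /k /nbhP[y yA xy] wx]; apply/nbhP; exists y => // i.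
  exact: near_trans (xy i).
- rewrite sat_neg sat_bot (ev_top ev).
  have /fin_all_exists[f _] : forall i, exists x : W i, True.
    by move=> i; case: (sim_nonempty (tsim_sim (W i))) => x; exists x.
  by apply/set0Pn; exists [ffun i => f i]; rewrite inE.
- by move=> s t taut; rewrite /satisfies beval_bmap.
- by move=> phi; rewrite sat1 (ev_dia true) dia_sup.
- by move=> phi; rewrite sat1 (ev_dia false) dia_sup.
- by move=> phi; rewrite sat1 !(ev_dia true) dia_dia.
- by move=> phi; rewrite sat1 !(ev_dia false) dia_dia.
(* With no coordinates the diamond of the empty set would be the whole space; [M0] provides a
   coordinate at which a witness is demanded. *)
- rewrite sat_bot (ev_dia true) (ev_bot ev); apply/eqP/setP => w; rewrite [RHS]inE.
  by apply/negP => /diaP/(_ (Ordinal M0))[v]; rewrite inE.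
- rewrite sat_bot (ev_dia false) (ev_bot ev); apply/eqP/setP => w; rewrite [RHS]inE.
  by apply/negP => /diaP/(_ (Ordinal M0))[v]; rewrite inE.
- exact: (sound_linear true).
- exact: (sound_linear false).
(* At coordinate [i], [w] lies between [y] and [x], which agree there because [eps] fixes that
   coordinate. *)
- move=> i eps me; rewrite sat1 (ev_and ev) (ev_dia true) (ev_dia false).
  have [_ + _] := me; rewrite of_sort_vars_in => /determined_eval de.
  apply/subsetP => w /setIP[/(dia_determined1 _ _ de)[x xe wx]].
  move=> /(dia_determined1 _ _ de)[y ye yw]; apply: (de _ _ _ xe) => j /eqP->.
  by apply: (@ord_anti _ _ _ false); rewrite // (one_sorted_mec_singleton me xe ye).
- exact: (sound_dia_near true).
- exact: (sound_dia_near false).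
- by move=> phi psi; exact: (@sound_disjoint true).
- by move=> phi psi; exact: (@sound_disjoint false).
- move=> phi rho sig c crho csig; rewrite sat_imp !sat_and.
  rewrite sat_neg sat_bot (ev_and ev); apply/implyP => /andP[/andP[rs]].
  move=> /satP hr /satP hs; apply/satP => w we; rewrite (ev_and ev).
  by apply: boxed_near; auto using boxed_diamonds.
- move=> phi phi' psi psi' c /disjoint_sortedP[I []]; rewrite !vars_in_and.
  move=> /andP[/determined_eval dp /determined_eval dq].
  move=> /andP[/determined_eval dp' /determined_eval dq'].
  rewrite sat_imp; apply/implyP.
  rewrite sat_neg sat_bot (ev_and ev) => /set0Pn[z /setIP[zp zp']].
  rewrite /satisfies beval_iff; apply/eqP; apply/andP/idP.
    move=> [/satP h /satP k]; apply/satP => w; rewrite !(ev_and ev).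
    move=> /setIP[/h/nbhP[x xq wx] /k/nbhP[y yq wy]]; apply/nbhP.
    exists (mix I x y) => [|i]; last by rewrite mixE; case: ifP.
    by rewrite inE determined_mixl ?determined_mixr.
  (* The common point [z] completes a point of one conjunct to a point of both. The witness found is
     then spliced with [w], which costs no similarity on the other coordinates. *)
  move=> /satP h; split; apply/satP => w wp.
    have /h/nbhP[x] : mix I w z \in e (BAnd phi phi').
      by rewrite (ev_and ev) inE determined_mixl ?determined_mixr.
    rewrite (ev_and ev) => /setIP[xq _] wx; apply/nbhP; exists (mix I x w).
      exact: determined_mixl.
    by move=> i; have := wx i; rewrite !mixE; case: ifP => // _ _; apply: near_refl.
  have /h/nbhP[x] : mix I z w \in e (BAnd phi phi').
    by rewrite (ev_and ev) inE determined_mixl ?determined_mixr.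
  rewrite (ev_and ev) => /setIP[_ xq] wx; apply/nbhP; exists (mix I w x).
    exact: determined_mixr.
  by move=> i; have := wx i; rewrite !mixE; case: ifP => // _ _; apply: near_refl.
- by move=> phi chi psi; exact: (@sound_split false).
- by move=> phi chi psi; exact: (@sound_split true).
- move=> eps k me; have [e0|[w we]] := set_0Vmem (e eps).
    by apply/orP; left; apply/satP => w; rewrite e0 inE.
  rewrite sat_or; apply/orP; rewrite !sat1 (ev_neg ev).
  have [wk|wk] := boolP (w \in e (BVar (inr k))); [left|right];
    by apply/subsetP => x xe; rewrite (mec_singleton me xe we) ?inE.
Qed.

End Soundness.

Lemma soundness (R : realType) (V : grades R) (M : nat) (M0 : (0 < M)%N)
    (Ns : 'I_M -> nat) (N : nat) (T : formula V Ns N -> Prop)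
    (Phi : formula V Ns N) :
  derivable T Phi -> entails T Phi.
Proof.
move=> der W e ev sat; elim: der => [A /sat//|A|A B _ hA _].
  exact: sound_axiom.
by rewrite sat_imp hA.
Qed.

(** * The canonical model of a maximal theory *)

Section CompleteTheory.
Variables (R : realType) (V : grades R).
Variables (M : nat) (M0 : (0 < M)%N) (Ns : 'I_M -> nat) (N : nat).
Variable (mu : gimp V Ns N -> bool).
Hypothesis muA : forall A, axiom A -> beval mu A.

Notation bexp := (bexp Ns N).
Implicit Types (phi psi chi eps : bexp) (c d : V) (b : bool) (i : 'I_M).

Definition imp c phi psi : bool := mu (GImp phi c psi).
Local Notation le := (imp (grade1 V)).
Local Notation inc phi := (imp (grade1 V) phi BBot).

(** * Derived rules for graded implications true under [mu] *)

Lemma imp_trans c d phi psi chi :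
  imp c phi psi -> imp d psi chi -> imp (odot c d) phi chi.
Proof.
move=> h k; have := muA (A9 phi psi chi c d).
by rewrite beval_imp /= -!/(imp _ _ _) h k.
Qed.

Lemma imp_le c phi psi chi : imp c phi psi -> le psi chi -> imp c phi chi.
Proof. by move=> h k; rewrite -(odotg1 c); apply: imp_trans k. Qed.

Lemma le_imp c phi psi chi : le phi psi -> imp c psi chi -> imp c phi chi.
Proof. by move=> h k; rewrite -(odot1 c); apply: imp_trans k. Qed.

Lemma imp_weaken c d phi psi : val d <= val c -> imp c phi psi -> imp d phi psi.
Proof. by move=> /(A3 phi psi)/muA; rewrite beval_imp => /implyP. Qed.

Lemma le_imp1 c phi psi : le phi psi -> imp c phi psi.
Proof. by apply: imp_weaken; apply: grade_le1. Qed.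

Lemma imp_or c phi psi chi :
  imp c phi chi -> imp c psi chi -> imp c (BOr phi psi) chi.
Proof.
move=> h k; have := muA (A7 phi psi chi c).
by rewrite beval_imp /= -!/(imp _ _ _) h k.
Qed.

Lemma imp_bot c phi : imp c phi BBot -> inc phi.
Proof. by have := muA (A5 phi c); rewrite beval_imp => /implyP. Qed.

Lemma imp0 phi psi : ~~ inc psi -> imp (grade0 V) phi psi.
Proof. by have := muA (A4 V phi psi); rewrite beval_imp => /implyP. Qed.

Lemma top_consistent : ~~ inc BTop.
Proof. exact: muA (A10 _ _ _). Qed.

Lemma le_taut (l : seq bexp) (p q : cform) :
  (forall v, ceval v p ==> ceval v q) ->
  le (csubst (nth BBot l) p) (csubst (nth BBot l) q).
Proof. by move=> /(A1 V (nth BBot l))/muA. Qed.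

Local Notation x0 := (CVar 0).
Local Notation x1 := (CVar 1).
Local Notation x2 := (CVar 2).
(* The schemes used contain at most three variables, so eight cases decide them. *)
Local Tactic Notation "taut" constr(l) constr(p) constr(q) :=
  let v := fresh "v" in refine (@le_taut l p q _); intro v; cbn;
  destruct (v 0%N), (v 1%N), (v 2%N); reflexivity.

Lemma le_refl phi : le phi phi.
Proof. taut [:: phi] x0 x0. Qed.

Lemma bot_le phi : le BBot phi.
Proof. taut [:: phi] CBot x0. Qed.

Lemma le_top phi : le phi BTop.
Proof. taut [:: phi] x0 CTop. Qed.

Lemma andl_le phi psi : le (BAnd phi psi) phi.
Proof. taut [:: phi; psi] (CAnd x0 x1) x0. Qed.

Lemma andr_le phi psi : le (BAnd phi psi) psi.
Proof. taut [:: phi; psi] (CAnd x0 x1) x1. Qed.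

Lemma le_orl phi psi : le phi (BOr phi psi).
Proof. taut [:: phi; psi] x0 (COr x0 x1). Qed.

Lemma le_orr phi psi : le psi (BOr phi psi).
Proof. taut [:: phi; psi] x1 (COr x0 x1). Qed.

Lemma le_em phi psi : le phi (BOr psi (BNeg psi)).
Proof. taut [:: phi; psi] x0 (COr x1 (CNeg x1)). Qed.

Lemma inc_imp c phi psi : inc phi -> imp c phi psi.
Proof. by move=> h; apply: le_imp1; apply: imp_le h (bot_le _). Qed.

Lemma le_and_neg phi psi : le phi psi -> inc (BAnd phi (BNeg psi)).
Proof. by have := muA (A2 V phi psi); rewrite beval_imp => /implyP. Qed.

(** [phi] is tautologically below the disjunction of the goal with [phi] and not [psi], and [phi]
    and not [chi]. The last two are inconsistent by [A2], so [A7] discards them. *)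
Lemma le_and phi psi chi : le phi psi -> le phi chi -> le phi (BAnd psi chi).
Proof.
move=> /le_and_neg h /le_and_neg k.
apply: (@imp_le _ _ (BOr (BAnd psi chi)
    (BOr (BAnd phi (BNeg psi)) (BAnd phi (BNeg chi))))).
  taut [:: phi; psi; chi] x0 (COr (CAnd x1 x2)
    (COr (CAnd x0 (CNeg x1)) (CAnd x0 (CNeg x2)))).
by apply: imp_or; rewrite ?le_refl //; apply: imp_or; apply: inc_imp.
Qed.

Lemma le_neg phi psi : le phi (BNeg psi) = inc (BAnd phi psi).
Proof.
apply/idP/idP => [/le_and_neg|h].
  apply: le_imp; taut [:: phi; psi] (CAnd x0 x1) (CAnd x0 (CNeg (CNeg x1))).
apply: (@imp_le _ _ (BOr (BNeg psi) (BAnd phi psi))).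
  taut [:: phi; psi] x0 (COr (CNeg x1) (CAnd x0 x1)).
by apply: imp_or; [apply: le_refl|apply: inc_imp].
Qed.

Lemma le_case phi psi : le phi (BOr (BAnd phi psi) (BAnd phi (BNeg psi))).
Proof. taut [:: phi; psi] x0 (COr (CAnd x0 x1) (CAnd x0 (CNeg x1))). Qed.

Lemma le_andA phi psi chi : le (BAnd (BAnd phi psi) chi) (BAnd phi (BAnd psi chi)).
Proof. taut [:: phi; psi; chi] (CAnd (CAnd x0 x1) x2) (CAnd x0 (CAnd x1 x2)). Qed.

Lemma le_andC phi psi : le (BAnd phi psi) (BAnd psi phi).
Proof. taut [:: phi; psi] (CAnd x0 x1) (CAnd x1 x0). Qed.

Lemma dia_le_sup b phi : le phi (BDia b phi).
Proof. by case: b; [apply: (muA (A12_le _ _))|apply: (muA (A12_ge _ _))]. Qed.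

Lemma dia_le_dia b phi : le (BDia b (BDia b phi)) (BDia b phi).
Proof. by case: b; [apply: (muA (A13_le _ _))|apply: (muA (A13_ge _ _))]. Qed.

Lemma dia_bot b : inc (BDia b BBot).
Proof. by case: b; [apply: (muA (A14_le _ _ _))|apply: (muA (A14_ge _ _ _))]. Qed.

Lemma dia_imp b c phi psi : imp c phi psi -> imp c (BDia b phi) (BDia b psi).
Proof.
by case: b; [have := muA (A17_le phi psi c)|have := muA (A17_ge phi psi c)];
  rewrite beval_imp => /implyP.
Qed.

Lemma dia_le_trans b phi psi chi :
  le phi (BDia b psi) -> le psi (BDia b chi) -> le phi (BDia b chi).
Proof.
move=> h /(dia_imp b) k; apply: imp_le h _; apply: imp_le k _; exact: dia_le_dia.
Qed.

Lemma dia_inc b i phi psi : vars_in (pred1 i) phi ->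
  inc (BAnd phi (BDia b psi)) -> inc (BAnd (BDia (~~ b) phi) (BDia b psi)).
Proof.
rewrite -of_sort_vars_in => hi; have os : one_sorted phi by exists i.
by case: b; [have := muA (A18_le V psi os)|have := muA (A18_ge V psi os)];
  rewrite beval_imp => /implyP.
Qed.

Lemma dia_split b I phi chi psi : vars_in I chi -> vars_in (predC I) psi ->
  inc (BAnd (BAnd (BDia b phi) chi) psi) ->
  inc (BAnd (BDia b phi) chi) || inc (BAnd (BDia b phi) psi).
Proof.
move=> hchi hpsi; have dis : disjoint_sorted chi psi.
  by apply/disjoint_sortedP; exists I.
by case: b; [have := muA (A21_le V phi dis)|have := muA (A21_ge V phi dis)];
  rewrite beval_imp => /implyP.
Qed.

Lemma and_imp_and I c phi phi' psi psi' :
  vars_in I phi -> vars_in I psi ->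
  vars_in (predC I) phi' -> vars_in (predC I) psi' -> ~~ inc (BAnd phi phi') ->
  imp c (BAnd phi phi') (BAnd psi psi') = imp c phi psi && imp c phi' psi'.
Proof.
move=> h k h' k' cns.
have dis : disjoint_sorted (BAnd phi psi) (BAnd phi' psi').
  by apply/disjoint_sortedP; exists I; rewrite !vars_in_and h k h' k'.
have := muA (A20 c dis); rewrite beval_imp beval_iff /= -!/(imp _ _ _) cns.
by move=> /eqP.
Qed.

(** [A8] applied to excluded middle: a m.e.c. decides every basic expression, including diamonds. *)
Lemma mec_dichotomy eps phi : mec eps -> le eps phi || le eps (BNeg phi).
Proof.
move=> /(A8 phi (BNeg phi) (grade1 V))/muA; rewrite beval_imp => /implyP; apply.
exact: le_em.
Qed.

Lemma mec_sym del eps c : mec del -> mec eps -> ~~ inc del ->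
  imp c del eps -> imp c eps del.
Proof.
move=> md me cns h; have := muA (A6 c md me).
by rewrite beval_imp /= -!/(imp _ _ _) cns h.
Qed.

Lemma le_and_inc phi psi : le phi psi -> le phi (BNeg psi) -> inc phi.
Proof.
move=> h; rewrite le_neg; apply: le_imp; apply: le_and; [exact: le_refl|exact: h].
Qed.

(** * One-sorted and full m.e.c.'s *)

Definition conjs (l : seq bexp) : bexp := foldr (fun phi psi => BAnd phi psi) BTop l.

Lemma conjs_le (I : eqType) (f : I -> bexp) l x :
  x \in l -> le (conjs (map f l)) (f x).
Proof.
elim: l => //= y l IH; rewrite inE => /orP[/eqP->|/IH]; first exact: andl_le.
by apply: le_imp; apply: andr_le.
Qed.

Lemma bvars_conjs l : bvars (conjs l) = flatten (map (@bvars M Ns N) l).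
Proof. by elim: l => //= x l ->. Qed.

Lemma vars_in_conjs I l : all (vars_in I) l -> vars_in I (conjs l).
Proof. by elim: l => //= x l IH /andP[hx /IH]; rewrite vars_in_and hx. Qed.

Lemma conj_of_conjs (J : eqType) (f : J -> bexp) P l :
  (forall x, conj_of P (f x)) -> conj_of P (conjs (map f l)).
Proof. by move=> h; elim: l => /= *; constructor. Qed.

Notation asg i := {ffun 'I_(Ns i) -> bool}.
Implicit Type (g h : forall i, asg i).

Definition sv i (k : 'I_(Ns i)) : svar Ns := Tagged (fun i => 'I_(Ns i)) k.

Definition lit (p : svar Ns) b : bexp :=
  if b then BVar (inl p) else BNeg (BVar (inl p)).

Definition onemec i (a : asg i) : bexp :=
  conjs [seq lit (sv k) (a k) | k <- enum 'I_(Ns i)].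

(** The list of sorts is a parameter so that sorts can be split off by induction and any sort can be
    listed first. *)
Definition gmec (s : seq 'I_M) g : bexp := conjs [seq onemec (g i) | i <- s].

Lemma bvars_onemec i (a : asg i) :
  bvars (onemec a) = [seq inl (sv k) | k <- enum 'I_(Ns i)].
Proof.
rewrite /onemec bvars_conjs; elim: (enum _) => //= k l ->.
by rewrite /lit; case: (a k).
Qed.

Lemma vars_in_onemec i (a : asg i) : vars_in (pred1 i) (onemec a).
Proof. by rewrite /vars_in bvars_onemec all_map; apply/allP => k _ /=. Qed.

Lemma vars_in_gmec (I : pred 'I_M) s g : all I s -> vars_in I (gmec s g).
Proof.
move=> /allP sI; apply: vars_in_conjs; rewrite all_map; apply/allP => i /sI Ii.
apply: sub_all (vars_in_onemec (g i)) => x.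
by case: (var_sort x) => //= j /eqP->.
Qed.

Lemma literal_onemec i (a : asg i) : conj_of (@literal M Ns N) (onemec a).
Proof.
by apply: conj_of_conjs => k; apply: conj_base; rewrite /lit; case: (a k).
Qed.

Lemma one_sorted_mec_onemec i (a : asg i) : one_sorted_mec i (onemec a).
Proof.
split; [exact: literal_onemec|by rewrite of_sort_vars_in vars_in_onemec|].
case=> j k /= ji; subst j; rewrite bvars_onemec count_uniq_mem.
  by rewrite map_f ?mem_enum.
by rewrite map_inj_uniq ?enum_uniq // => x y [] /eqP; rewrite eq_Tagged => /eqP.
Qed.

Lemma mec_gmec s g : uniq s -> (forall i, i \in s) -> mec (gmec s g).
Proof.
move=> us fs; split.
  by apply: conj_of_conjs => i; apply: literal_onemec.
case=> i k; rewrite /gmec bvars_conjs -map_comp.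
rewrite (eq_map (fun i => bvars_onemec (g i))) count_uniq_mem.
  have -> // : inl (existT _ i k) \in
      [seq (inl (sv k) : var Ns N) | i <- s, k <- enum 'I_(Ns i)].
  by apply/allpairsPdep; exists i, k; rewrite fs mem_enum.
apply: allpairs_uniq_dep => // [j _|]; first exact: enum_uniq.
by move=> [j x] [j' x'] _ _ /= [].
Qed.

Lemma lits_cases i (l : seq 'I_(Ns i)) c phi psi : uniq l ->
  (forall a : asg i,
    imp c (BAnd phi (conjs [seq lit (sv k) (a k) | k <- l])) psi) ->
  imp c phi psi.
Proof.
elim: l phi => [|k l IH] phi /=.
  move=> _ /(_ [ffun=> true]); apply: le_imp.
  by apply: le_and; [apply: le_refl|apply: le_top].
move=> /andP[kl ul] h; have st x : imp c (BAnd phi (lit (sv k) x)) psi.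
  (* Overriding [a] at [k] makes the case [x] an instance of the hypothesis; [k] is not in [l], so
     the remaining literals are unchanged. *)
  apply: IH => // a; pose a' : asg i := [ffun j => if j == k then x else a j].
  apply: le_imp (h a'); rewrite ffunE eqxx.
  rewrite (_ : map _ l = [seq lit (sv k) (a k) | k <- l]); first exact: le_andA.
  apply/eq_in_map => j jl; rewrite ffunE; case: eqP => // jk.
  by rewrite -jk jl in kl.
apply: le_imp (le_case phi (BVar (inl (sv k)))) _.
by apply: imp_or; [apply: (st true)|apply: (st false)].
Qed.

Lemma gmec_cases s c phi psi : uniq s ->
  (forall g, imp c (BAnd phi (gmec s g)) psi) -> imp c phi psi.
Proof.
elim: s phi => [|i s IH] phi /=.
  move=> _ /(_ (fun i => [ffun=> true])); apply: le_imp.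
  by apply: le_and; [apply: le_refl|apply: le_top].
move=> /andP[is_ us] h; apply: (lits_cases (enum_uniq 'I_(Ns i))) => a.
apply: IH => // g; apply: le_imp (h (dfwith g a)); rewrite /gmec /= dfwith_in.
rewrite (_ : map _ s = [seq onemec (g i) | i <- s]); first exact: le_andA.
apply/eq_in_map => j js; rewrite dfwith_out //.
by apply: contra is_ => /eqP->.
Qed.

Lemma gmec_le s g i : i \in s -> le (gmec s g) (onemec (g i)).
Proof. exact: conjs_le. Qed.

Lemma eq_gmec s g h : {in s, forall i, g i = h i} -> gmec s g = gmec s h.
Proof. by move=> gh; congr conjs; apply/eq_in_map => i /gh ->. Qed.

(** Repeated use of [A21]: a clash between a diamond and a m.e.c. is already a clash with one of its
    sorts. The first alternative is what remains when all sorts are split off. *)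
Lemma dia_gmec_inc b phi s g : uniq s -> inc (BAnd (BDia b phi) (gmec s g)) ->
  inc (BDia b phi) \/ exists i, inc (BAnd (BDia b phi) (onemec (g i))).
Proof.
elim: s => [_ h|i s IH /andP[is_ us]].
  by left; apply: le_imp h; apply: le_and; [apply: le_refl|apply: le_top].
have vs : vars_in (predC (pred1 i)) (gmec s g).
  by apply: vars_in_gmec; apply/allP => j js /=; apply: contra is_ => /eqP<-.
move=> /(le_imp (le_andA _ _ _))/(dia_split (vars_in_onemec (g i)) vs)/orP.
by case=> [h|/(IH us)//]; right; exists i.
Qed.

Definition possible i (a : asg i) : bool := ~~ inc (onemec a).

(** With [BTop] under the diamond, [A21] speaks of plain conjunctions: consistent m.e.c.'s of
    different sorts combine freely, which makes the worlds a full product. *)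
Lemma gmec_possible s g : uniq s -> (forall i, possible (g i)) -> ~~ inc (gmec s g).
Proof.
move=> us pg; apply/negP => h.
case: (@dia_gmec_inc true BTop s g us) => [|h'|[i h']].
- by apply: le_imp h; apply: andr_le.
- by case/negP: top_consistent; apply: le_imp h'; apply: dia_le_sup.
- case/negP: (pg i); apply: le_imp h'; apply: le_and (le_refl _).
  by apply: (imp_le (le_top _)); apply: dia_le_sup.
Qed.

Lemma possible_exists i : exists a : asg i, possible a.
Proof.
apply/existsP; apply: contraT; rewrite negb_exists => /forallP h.
case/negP: top_consistent; apply: (lits_cases (enum_uniq 'I_(Ns i))) => a.
by apply: le_imp (negbNE (h a)); apply: andr_le.
Qed.

Lemma possible_extend i (a : asg i) : possible a ->
  exists g, (forall j, possible (g j)) /\ g i = a.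
Proof.
move=> pa; have [g pg] := fin_all_exists possible_exists.
exists (dfwith g a); split=> [j|]; last exact: dfwith_in.
by case: dfwithP => [|k _].
Qed.

(** [A20] splits off one sort at a time, its consistency premise being [gmec_possible]. This is why
    the similarity of worlds is the minimum over the coordinates. *)
Lemma gmec_imp c s g h : uniq s -> (forall i, possible (g i)) ->
  imp c (gmec s g) (gmec s h) =
  all (fun i => imp c (onemec (g i)) (onemec (h i))) s.
Proof.
move=> us pg; elim: s us => [_|i s IH /= /andP[is_ us]].
  by apply: le_imp1; apply: le_refl.
rewrite -(IH us) /gmec /= (@and_imp_and (pred1 i)) ?vars_in_onemec //.
- by apply: vars_in_gmec; apply/allP => j js /=; apply: contra is_ => /eqP<-.
- by apply: vars_in_gmec; apply/allP => j js /=; apply: contra is_ => /eqP<-.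
- by apply: (@gmec_possible (i :: s)); rewrite //= is_.
Qed.

(* A m.e.c. listing sort [i] first, so that A20 can split that sort off. *)
Definition from_sort i : seq 'I_M := i :: rem i (enum 'I_M).

Lemma perm_from_sort i : perm_eq (enum 'I_M) (from_sort i).
Proof. by apply: perm_to_rem; rewrite mem_enum. Qed.

Lemma from_sort_uniq i : uniq (from_sort i).
Proof. by rewrite -(perm_uniq (perm_from_sort i)) enum_uniq. Qed.

Lemma mem_from_sort i j : j \in from_sort i.
Proof. by rewrite -(perm_mem (perm_from_sort i)) mem_enum. Qed.

(** [A8] concerns full m.e.c.'s, so [a] is extended by consistent m.e.c.'s of the other sorts, [phi]
    is decided there, and [A20] removes the extension. *)
Lemma onemec_dichotomy i (a : asg i) phi : possible a -> vars_in (pred1 i) phi ->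
  le (onemec a) phi || le (onemec a) (BNeg phi).
Proof.
move=> /possible_extend[g [pg <-]] vphi; have us := from_sort_uniq i.
have is_ : i \notin rem i (enum 'I_M) by case/andP: us.
pose r := rem i (enum 'I_M); rewrite -/r in is_.
have vr : vars_in (predC (pred1 i)) (gmec r g).
  by apply: vars_in_gmec; apply/allP => j js /=; apply: contraNneq is_ => <-.
have down psi : vars_in (pred1 i) psi -> le (gmec (from_sort i) g) psi ->
    le (onemec (g i)) psi.
  move=> vpsi h; suff : le (gmec (from_sort i) g) (BAnd psi (gmec r g)).
    rewrite [gmec _ _]/= -/r -/(gmec r g).
    rewrite (@and_imp_and (pred1 i)) ?vars_in_onemec //.
      by case/andP.
    exact: (gmec_possible us).
  by apply: le_and h _; apply: andr_le.
have /mec_dichotomy : mec (gmec (from_sort i) g).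
  by apply: mec_gmec us _ => j; apply: mem_from_sort.
by move=> /(_ phi)/orP[] /down-> //; rewrite orbT.
Qed.

(** Both sides are extended by the same m.e.c.'s of the other sorts; [A6] applies to the full
    m.e.c.'s and [gmec_imp] returns to sort [i]. *)
Lemma onemec_sym i (a a' : asg i) c : possible a -> possible a' ->
  imp c (onemec a) (onemec a') = imp c (onemec a') (onemec a).
Proof.
suff gen (x y : asg i) : possible x -> possible y ->
    imp c (onemec x) (onemec y) -> imp c (onemec y) (onemec x).
  by move=> pa pa'; apply/idP/idP; apply: gen.
move=> px py h; have [g [pg gi]] := possible_extend px.
pose g' := dfwith g y; have g'i : g' i = y by apply: dfwith_in.
have pg' j : possible (g' j) by rewrite /g'; case: dfwithP.
have us := enum_uniq 'I_M; have fs j : j \in enum 'I_M by rewrite mem_enum.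
have : imp c (gmec (enum 'I_M) g) (gmec (enum 'I_M) g').
  rewrite gmec_imp //; apply/allP => j _; rewrite /g'.
  case: dfwithP => [|k _]; first by rewrite gi.
  by apply: le_imp1; apply: le_refl.
move/(mec_sym (mec_gmec g us fs) (mec_gmec g' us fs) (gmec_possible us pg)).
by rewrite gmec_imp // => /allP/(_ i (fs i)); rewrite gi g'i.
Qed.

Lemma onemec_lit i (a : asg i) k : le (onemec a) (lit (sv k) (a k)).
Proof. by apply: (conjs_le (fun k => lit (sv k) (a k))); rewrite mem_enum. Qed.

Lemma onemec_inj i (a a' : asg i) :
  possible a -> le (onemec a) (onemec a') -> a = a'.
Proof.
move=> pa h; apply/ffunP => k; apply: contraNeq pa => ak.
have := onemec_lit a k; have := imp_le h (onemec_lit a' k).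
by case: (a k) (a' k) ak => -[] //= _ l1 l2;
  [apply: le_and_inc l2 l1|apply: le_and_inc l1 l2].
Qed.

(** Otherwise [y] would clash with the opposite diamond of [x]. By [A18] the diamond of [y] would
    clash with it too, yet [x] lies below both. *)
Lemma onemec_dual i (a a' : asg i) b : possible a -> possible a' ->
  le (onemec a) (BDia b (onemec a')) = le (onemec a') (BDia (~~ b) (onemec a)).
Proof.
suff gen (x y : asg i) (d : bool) : possible x -> possible y ->
    le (onemec x) (BDia d (onemec y)) -> le (onemec y) (BDia (~~ d) (onemec x)).
  move=> pa pa'; apply/idP/idP; first exact: gen.
  by move/gen; rewrite negbK; apply.
move=> px py h.
have /(onemec_dichotomy py)/orP[//|] :
    vars_in (pred1 i) (BDia (~~ d) (onemec x)).
  by rewrite vars_in_dia vars_in_onemec.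
rewrite le_neg => /(dia_inc (vars_in_onemec y)); rewrite negbK => k.
case/negP: px; apply: le_imp k; apply: le_and h _; exact: dia_le_sup.
Qed.

(** * The chain of consistent m.e.c.'s of one sort *)

Section Chain.
Variable i : 'I_M.

Definition point : finType := {a : asg i | possible a}.
Implicit Types x y z : point.

Definition pt x : bexp := onemec (val x).

(** The default [grade0] is admissible by [A4], since [y] is consistent; by [A3] the admissible
    grades are downward closed. *)
Definition psim x y : V :=
  [arg max_(c > grade0 V | imp c (pt x) (pt y)) val c]%O.

Lemma psim_imp c x y : (val c <= val (psim x y)) = imp c (pt x) (pt y).
Proof.
rewrite /psim; case: Order.TotalTheory.arg_maxP => [|d hd maxd].
  by apply: imp0; apply: valP y.
by apply/idP/idP => [cd|/maxd//]; apply: imp_weaken hd.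
Qed.

Lemma psimC x y : psim x y = psim y x.
Proof.
suff h u v : val (psim u v) <= val (psim v u) by apply/val_inj/le_anti; rewrite !h.
rewrite psim_imp /pt onemec_sym; [|exact: valP|exact: valP].
by rewrite -!/(pt _) -psim_imp.
Qed.

Lemma psim_sim : is_similarity psim.
Proof.
split.
- by have [a pa] := possible_exists i; exists; exists a.
- move=> x y; split=> [xy|->].
    have : le (pt x) (pt y) by rewrite -psim_imp xy.
    by move/(onemec_inj (valP x))/val_inj.
  by apply/val_inj/le_anti; rewrite grade_le1 psim_imp le_refl.
- exact: psimC.
- move=> x y z; rewrite psim_imp.
  by apply: (@imp_trans _ _ _ (pt y)); rewrite -psim_imp.
Qed.

Definition ple x y : bool := le (pt x) (BDia true (pt y)).

Lemma ple_dual b x y : le (pt x) (BDia b (pt y)) = if b then ple x y else ple y x.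
Proof. by case: b; rewrite // /pt (onemec_dual _ (valP x) (valP y)). Qed.

Lemma ple_refl : reflexive ple.
Proof. by move=> x; apply: dia_le_sup. Qed.

(** By duality [x] lies below both diamonds of [y], and [A16] puts it below [y]. *)
Lemma ple_anti : antisymmetric ple.
Proof.
move=> x y /andP[xy yx]; apply/val_inj; apply: onemec_inj (valP x) _.
have := muA (A16 V (one_sorted_mec_onemec (val y))); apply: le_imp.
by apply: le_and; [apply: xy|rewrite (ple_dual false)].
Qed.

Lemma ple_trans : transitive ple.
Proof. by move=> y x z; apply: dia_le_trans. Qed.

Lemma ple_total : total ple.
Proof.
move=> x y.
have o z : of_sort i (pt z) by rewrite of_sort_vars_in vars_in_onemec.
have /orP[h|h] := muA (A15_le V (o x) (o y)); apply/orP; [left|right];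
  by apply: le_imp h; apply: (dia_le_sup true).
Qed.

Lemma ple_sim x y z : ple x y -> ple y z ->
  val (psim x z) <= Num.min (val (psim x y)) (val (psim y z)).
Proof.
move=> xy yz.
(* [u] lies below one diamond of [y], and it implies the other to the degree to which it implies
   [v]. [A19] joins the two diamonds, which are consistent together because of [y], and [A16]
   reduces them to [y]. *)
have mid b u v : le (pt u) (BDia b (pt y)) -> le (pt v) (BDia (~~ b) (pt y)) ->
    val (psim u v) <= val (psim u y).
  move=> uy vy; rewrite psim_imp.
  apply: (@imp_le _ _ (BAnd (BDia true (pt y)) (BDia false (pt y)))); last first.
    exact: (muA (A16 V (one_sorted_mec_onemec (val y)))).
  have cuv : imp (psim u v) (pt u) (pt v) by rewrite -psim_imp.
  have dd b' : conj_of (@diamond M Ns N) (BDia b' (pt y)).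
    by apply: conj_base; case: b'.
  have h b' : imp (psim u v) (pt u) (BDia b' (pt y)).
    have [->|/negbTE bb] := eqVneq b' b; first exact: le_imp1.
    suff -> : b' = ~~ b by apply: imp_le cuv vy.
    by move: bb; case: (b); case: (b').
  have := muA (A19 (pt u) (psim u v) (dd true) (dd false)).
  rewrite beval_imp /= -!/(imp _ _ _) (h true) (h false) !andbT => /implyP; apply.
  apply: contra (valP y) => k; apply: le_imp k.
  by apply: le_and; [apply: (dia_le_sup true)|apply: (dia_le_sup false)].
rewrite le_min (mid true) ?(ple_dual false) //=.
by rewrite (psimC x) (psimC y) (mid false) // (ple_dual false).
Qed.

Definition chain : tosspace V :=
  TOSSpace psim_sim ple_refl ple_anti ple_trans ple_total ple_sim.

Lemma near_psim c (x y : chain) : near c x y = imp c (pt x) (pt y).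
Proof. exact: psim_imp. Qed.

Lemma ord_ple b (x y : chain) : ord b x y = le (pt x) (BDia b (pt y)).
Proof. by rewrite ple_dual. Qed.

End Chain.

(** * The evaluation in the product of the chains *)

Notation W := (world chain).
Implicit Types (u v w : W).

Definition mec_of w : bexp := gmec (enum 'I_M) (fun i => val (w i)).

Definition eval phi : {set W} := [set w : W | le (mec_of w) phi].

Lemma mem_eval phi w : (w \in eval phi) = le (mec_of w) phi.
Proof. by rewrite inE. Qed.

Lemma mec_of_mec w : mec (mec_of w).
Proof. by apply: mec_gmec; [apply: enum_uniq|move=> i; rewrite mem_enum]. Qed.

Lemma mec_of_possible w : ~~ inc (mec_of w).
Proof. by apply: gmec_possible; [apply: enum_uniq|move=> i; apply: valP]. Qed.

Lemma mec_of_pt w i : le (mec_of w) (pt (w i)).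
Proof. by apply: (@gmec_le _ (fun i => val (w i))); rewrite mem_enum. Qed.

Lemma mec_of_dichotomy w phi : le (mec_of w) (BNeg phi) = ~~ le (mec_of w) phi.
Proof.
have /orP[h|h] := mec_dichotomy phi (mec_of_mec w); rewrite h.
  by apply/negbTE; apply: contra (mec_of_possible w); apply: le_and_inc.
by apply/esym; apply: contra (mec_of_possible w) => k; apply: le_and_inc h.
Qed.

Lemma mec_of_imp c v w :
  imp c (mec_of v) (mec_of w) = [forall i, near c (v i) (w i)].
Proof.
rewrite gmec_imp ?enum_uniq // => [|i]; last exact: valP.
apply/allP/forallP => h i; last by rewrite -/(pt _) -near_psim.
by rewrite near_psim; apply: h; rewrite mem_enum.
Qed.

(* Every basic expression is the disjunction of the consistent m.e.c.'s below it. *)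
Lemma eval_cases c phi psi :
  (forall w, w \in eval phi -> imp c (mec_of w) psi) -> imp c phi psi.
Proof.
move=> h; apply: (gmec_cases (enum_uniq 'I_M)) => g.
have [/forallP pg|/forallPn[i]] := boolP [forall i, possible (g i)]; last first.
  rewrite negbK => ig; apply: inc_imp; apply: le_imp ig.
  by apply: le_imp (andr_le _ _) _; apply: gmec_le; rewrite mem_enum.
pose w : W := [ffun i => exist _ (g i) (pg i)].
have -> : gmec (enum 'I_M) g = mec_of w.
  by apply: eq_gmec => i _; rewrite ffunE.
have [wphi|] := boolP (w \in eval phi).
  exact: le_imp (andr_le _ _) (h _ wphi).
rewrite mem_eval -mec_of_dichotomy le_neg => k; apply: inc_imp.
by apply: le_imp k; apply: le_andC.
Qed.

Lemma mec_of_or c w phi psi : imp c (mec_of w) (BOr phi psi) ->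
  imp c (mec_of w) phi || imp c (mec_of w) psi.
Proof.
by have := muA (A8 phi psi c (mec_of_mec w)); rewrite beval_imp => /implyP.
Qed.

(** [A8] selects a disjunct step by step; [A5] excludes the empty disjunction, as the m.e.c. of [w]
    is consistent. *)
Lemma mec_of_bigor c w (l : seq W) :
  imp c (mec_of w) (foldr (fun v phi => BOr (mec_of v) phi) BBot l) ->
  exists2 v, v \in l & imp c (mec_of w) (mec_of v).
Proof.
elim: l => [/imp_bot h|v l IH /mec_of_or/orP[h|/IH[u ul h]]].
- by case/negP: (mec_of_possible w).
- by exists v; rewrite ?mem_head.
- by exists u; rewrite // inE ul orbT.
Qed.

Lemma le_bigor (l : seq W) v : v \in l ->
  le (mec_of v) (foldr (fun v phi => BOr (mec_of v) phi) BBot l).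
Proof.
elim: l => //= u l IH; rewrite inE => /orP[/eqP->|/IH h]; first exact: le_orl.
exact: imp_le h (le_orr _ _).
Qed.

Lemma eval_dia b phi : eval (BDia b phi) = dia b (eval phi).
Proof.
apply/setP => w; rewrite mem_eval; apply/idP/diaP => [h i|h].
  have [e0|[v0 v0e]] := set_0Vmem (eval phi).
    case/negP: (mec_of_possible w); apply: imp_le h _.
    apply: imp_le (dia_bot b); apply: dia_imp; apply: eval_cases => v.
    by rewrite e0 inE.
  (* [r] is reversed because [extremumP] returns a least element: [v] is the farthest world of [phi]
     in direction [b] at coordinate [i]. *)
  pose r : rel (chain i) := fun x y => ord b y x.
  have [|||v ve maxv] :=
    @extremumP _ _ r v0 (mem (eval phi)) (fun v : W => v i) _ _ _ v0e.
  - exact: ord_refl.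
  - by move=> y x z xy yz; apply: ord_trans yz xy.
  - by move=> x y; apply: ord_total.
  exists v => //; rewrite ord_ple.
  have below : le (BDia b phi) (BDia b (pt (v i))).
    apply: (dia_le_trans (le_refl _)); apply: eval_cases => u /maxv.
    by rewrite /r ord_ple; apply: le_imp; apply: mec_of_pt.
  (* The bound [below] is of sort [i], so coordinate [i] of [w] decides it; a negative answer would
     make the m.e.c. of [w] inconsistent. *)
  have /(onemec_dichotomy (valP (w i)))/orP[//|k] :
      vars_in (pred1 i) (BDia b (pt (v i))).
    by rewrite vars_in_dia vars_in_onemec.
  case/negP: (mec_of_possible w); apply: le_and_inc (imp_le h below) _.
  by apply: le_imp k; apply: mec_of_pt.
(* Otherwise the m.e.c. of [w] clashes with the diamond. By [A21] a single sort [i] is to blame, and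
   [A18] moves the clash to the opposite diamond of [w i], while the witness [v] satisfies both
   diamonds. *)
apply: contraT; rewrite -mec_of_dichotomy le_neg => /(le_imp (le_andC _ _)).
have clash v psi : v \in eval phi -> le (mec_of v) psi ->
    ~~ inc (BAnd psi (BDia b phi)).
  rewrite mem_eval => vphi vpsi; apply: contra (mec_of_possible v); apply: le_imp.
  by apply: le_and vpsi (imp_le vphi (dia_le_sup _ _)).
move=> /(dia_gmec_inc (enum_uniq 'I_M))[k|[i k]].
  have [v ve _] := h (Ordinal M0); case/negP: (clash v BTop ve (le_top _)).
  by apply: le_imp k; apply: andr_le.
have [v ve wv] := h i.
have vb : le (mec_of v) (BDia (~~ b) (pt (w i))).
  apply: le_imp (mec_of_pt v i) _; rewrite -onemec_dual; [|exact: valP|exact: valP].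
  by rewrite -ord_ple.
case/negP: (clash v _ ve vb); apply: (@dia_inc _ i); first exact: vars_in_onemec.
by apply: le_imp k; apply: le_andC.
Qed.

Lemma eval_var w i (k : 'I_(Ns i)) : (w \in eval (BVar (inl (sv k)))) = val (w i) k.
Proof.
rewrite mem_eval; have := le_imp (mec_of_pt w i) (onemec_lit (val (w i)) k).
by case: (val (w i) k) => //=; rewrite mec_of_dichotomy => /negbTE.
Qed.

Lemma eval_evaluation : is_evaluation eval.
Proof.
split.
- move=> phi psi; apply/setP => w; rewrite in_setI !mem_eval.
  apply/idP/andP => [h|[]]; last exact: le_and.
  by split; apply: imp_le h _; [apply: andl_le|apply: andr_le].
- move=> phi psi; apply/setP => w; rewrite in_setU !mem_eval.
  apply/idP/orP => [/mec_of_or/orP//|[]h].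
    exact: imp_le h (le_orl _ _).
  exact: imp_le h (le_orr _ _).
- by move=> phi; apply/setP => w; rewrite in_setC !mem_eval mec_of_dichotomy.
- by apply/setP => w; rewrite mem_eval in_set0; apply/negbTE/mec_of_possible.
- by apply/setP => w; rewrite mem_eval in_setT le_top.
- move=> v w /eqP vw; have [i /eqP vwi] : exists i, v i != w i.
    apply/existsP; apply: contraT; rewrite negb_exists => /forallP h.
    by case/negP: vw; apply/eqP/ffunP => i; apply/eqP; apply: negbNE.
  have [k vwk] : exists k, val (v i) k != val (w i) k.
    apply/existsP; apply: contraT; rewrite negb_exists => /forallP h.
    by case: vwi; apply/val_inj/ffunP => k; apply/eqP; apply: negbNE.
  by exists (inl (sv k)); rewrite !eval_var.
- case=> i k; exists [set x : chain i | val x k]; apply/setP => w.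
  by rewrite (eval_var w k) !inE.
- move=> k.
  (* Each world of the set contributes all signed sorted variables true at it; these determine the
     world. *)
  exists [set [set l | w \in eval_slit eval l] | w in eval (BVar (inr k))].
  apply/setP => w; apply/idP/bigcupP => [wk|[L /imsetP[u uk ->] /bigcapP h]].
    exists [set l | w \in eval_slit eval l]; first exact: imset_f.
    by apply/bigcapP => l; rewrite inE.
  suff -> : w = u by []; apply/ffunP => i; apply/val_inj/ffunP => j.
  rewrite -!eval_var.
  have [ju|ju] := boolP (u \in eval (BVar (inl (sv j)))).
    by have := h (sv j, true); rewrite inE => /(_ ju).
  by have := h (sv j, false); rewrite inE /eval_slit /= !in_setC => /(_ ju)/negbTE.
- exact: (eval_dia true).
- exact: (eval_dia false).
Qed.

Lemma eval_sat (A : gimp V Ns N) : sat_gimp eval A = mu A.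
Proof.
case: A => phi c psi; rewrite /sat_gimp /= -[RHS]/(imp c phi psi).
apply/subsetP/idP => [h|h w].
  apply: eval_cases => w /h /nbhP[v ve wv]; rewrite mem_eval in ve.
  by apply: imp_le ve; rewrite mec_of_imp; apply/forallP.
rewrite mem_eval => wphi; apply/nbhP.
(* [psi] lies below the finite disjunction of its worlds, from which [mec_of_bigor] selects the
   world near [w]. *)
have below : le psi (foldr (fun v phi => BOr (mec_of v) phi) BBot (enum (eval psi))).
  by apply: eval_cases => v ve; apply: le_bigor; rewrite mem_enum.
have /mec_of_bigor[v ve wv] := imp_le (le_imp wphi h) below.
by exists v; [rewrite mem_enum in ve|apply/forallP; rewrite -mec_of_imp].
Qed.

End CompleteTheory.

Theorem theorem4p6 (R : realType) (V : grades R) (M : nat) (hM : (0 < M)%N)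
    (Ns : 'I_M -> nat) (N : nat)
    (T : formula V Ns N -> Prop) (Phi : formula V Ns N) :
  derivable T Phi <-> entails T Phi.
Proof.
split; first exact: soundness.
move=> ent; apply: contrapT => /lindenbaum[mu [muA muT /negP]]; apply.
have sat A : satisfies (eval muA) A = beval mu A.
  by apply: eq_beval => g; apply: eval_sat.
by rewrite -sat; apply: ent => [|A /muT]; [apply: eval_evaluation|rewrite sat].
Qed.
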